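(* Let $\Delta\ge3$ be an integer and let $T$ be a tree of maximum degree $\Delta$ such that $\sigma_{LL}(T)\le\sigma_{LL}(T')$ for every tree $T'$ of maximum degree at most $\Delta$ with $|V_L(T')|=|V_L(T)|$. Let $v$ be a central node of $T$, and regard $T$ as rooted at $v$ (i.e. placed on levels $\mathbf{L}_0,\mathbf{L}_1,\dots$ with node $w$ on level $d_T(v,w)$). Then (with a suitable left-to-right ordering of children) $T\in\mathfrak{T}(\Delta,\Delta)$ as a tree rooted at $v$, and for every node $u\neq v$ the subtree $T_u$, rooted at $u$, belongs to $\mathfrak{T}(\Delta-1,\Delta)$.
   Context: For a tree $T$, $V_L(T)$ is its set of leaves, $d_T$ the path distance, and $\sigma_{LL}(T)=\sum_{\{x,y\}\subseteq V_L(T),\,x\ne y} d_T(x,y)$. A node $v$ of a tree with $n$ nodes is central if every component of $T-v$ has at most $n/2$ nodes. For $T$ rooted at $v$ and $u\neq v$, $T_u$ is the subtree consisting of all nodes $w$ such that $u$ lies on the path from $w$ to $v$. For integers $\Delta\ge3$, $\mathcal{R}\in\{\Delta,\Delta-1\}$ put $M_0=1$ and $M_k=1+\mathcal{R}+\mathcal{R}(\Delta-1)+\dots+\mathcal{R}(\Delta-1)^{k-1}$ for $k\ge1$. The family $\mathfrak{T}(\mathcal{R},\Delta)$ contains, for each $n\ge1$, exactly one rooted tree with $n$ nodes (up to isomorphism), defined as follows: let $M_k\le n<M_{k+1}$; nodes lie on levels $\mathbf{L}_0,\dots,\mathbf{L}_{k+1}$ with children ordered left to right; the root on $\mathbf{L}_0$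 has $\min\{n-1,\mathcal{R}\}$ children; for $1\le i\le k-1$ every node on $\mathbf{L}_i$ has exactly $\Delta-1$ children; writing $n-M_k=m(\Delta-1)+r$ with $0\le r<\Delta-1$, the $m$ leftmost nodes on $\mathbf{L}_k$ each have $\Delta-1$ children, the $(m+1)$-st node from the left on $\mathbf{L}_k$ has $r$ children, and no other node on $\mathbf{L}_k$ has children. *)

(* Defs.v *)
From mathcomp Require Export all_boot.

Set Implicit Arguments.
Unset Strict Implicit.
Unset Printing Implicit Defensive.

Section Graphs.

Variables (V : finType) (e : rel V).

(* A cycle is a cyclic sequence of at least three distinct nodes; [ucycle]
   alone also holds for an edge traversed back and forth. *)
Definition is_tree : Prop :=
  [/\ symmetric e, irreflexive e, 0 < #|V|,
      (forall x y, connect e x y)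
    & (forall c : seq V, ucycle e c -> size c <= 2)].

Definition degree (x : V) : nat := #|[set y | e x y]|.

Definition max_degree : nat := \max_(x : V) degree x.

Definition leaves : {set V} := [set x | degree x == 1].

Definition walk_of_length (x y : V) (n : nat) : bool :=
  [exists p : n.-tuple V, path e x p && (last x p == y)].

(* Least length of a walk; the search range suffices when x and y are
   connected, and the value is #|V| otherwise. *)
Definition dist (x y : V) : nat := find (walk_of_length x y) (iota 0 #|V|).

(* [enum_rank] only serves to count each unordered pair once. *)
Definition sigma_LL : nat :=
  \sum_(x in leaves) \sum_(y in leaves | enum_rank x < enum_rank y) dist x y.

Definition component_without (v x : V) : {set V} :=
  [set y | connect [rel a b | [&& a != v, b != v & e a b]] x y].

Definition central (v : V) : Prop :=
  forall x, x != v -> 2 * #|component_without v x| <= #|V|.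

(* u lies on a simple path from w to v; such a path w :: p has fewer than #|V|
   edges, so the bound on its length is harmless. *)
Definition on_path (w v u : V) : bool :=
  [exists n : 'I_#|V|, exists p : n.-tuple V,
    [&& path e w p, last w p == v, uniq (w :: p) & u \in w :: p]].

Definition subtree (v u : V) : {set V} := [set w | on_path w v u].

Definition induced (A : {set V}) : rel {x : V | x \in A} :=
  fun x y => e (val x) (val y).

Variable root : V.

Definition level (x : V) : nat := dist root x.

Definition children (x : V) : {set V} :=
  [set y | e x y && (level y == (level x).+1)].

(* Orderings of the children of every node, given as the left-to-right orders
   they induce on the levels; [lt] is only meaningful inside a level. *)
Definition left_to_right (lt : rel V) : Prop :=
  [/\ irreflexive lt,
      (forall x y z, level x = level y -> level y = level z ->
         lt x y -> lt y z -> lt x z),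
      (forall x y, level x = level y -> x != y -> lt x y || lt y x)
    & (forall x y x' y', level x = level y -> lt x y ->
         x' \in children x -> y' \in children y -> lt x' y')].

Definition position (lt : rel V) (x : V) : nat :=
  #|[set y | (level y == level x) && lt y x]|.

End Graphs.

Arguments induced {V} e A x y.

Definition M (R Delta k : nat) : nat := 1 + \sum_(i < k) R * Delta.-1 ^ i.

(* Membership of the tree e rooted at root in the family T(R, Delta), the
   children being ordered by lt. Positions are counted from 0. *)
Definition in_family (R Delta : nat) (V : finType) (e : rel V) (root : V)
    (lt : rel V) : Prop :=
  [/\ is_tree e, left_to_right e root lt
    & exists k : nat,
      let m := (#|V| - M R Delta k) %/ Delta.-1 in
      let r := (#|V| - M R Delta k) %% Delta.-1 in
      [/\ M R Delta k <= #|V| < M R Delta k.+1,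
          (forall w, level e root w <= k.+1),
          #|children e root root| = minn (#|V| - 1) R,
          (forall w, 1 <= level e root w <= k.-1 ->
             #|children e root w| = Delta.-1)
        & (forall w, level e root w = k ->
             #|children e root w| =
               if position e root lt w < m then Delta.-1
               else if position e root lt w == m then r else 0)]].

(* Main.v *)
Require Import Defs.
From mathcomp Require Import all_boot.
From mathcomp Require Import zify.

Set Implicit Arguments.
Unset Strict Implicit.
Unset Printing Implicit Defensive.

(** Write b = Delta - 1, let L be the number of leaves, and root T at a node
    below each of whose neighbours there are at most L/2 leaves. With l(u) the
    number of leaves below u, sigma_LL(T) is the sum of l(u)(L - l(u)) over
    u <> root, and x(L - x) is, for x <= L/2, a positive combination of the
    functions min(x, t), t <= L/2. So it suffices to compare the sums S_t of the
    min(l(u), t) with those of the tree G of the family that has L leaves (a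
    b-ary heap).

    Cutting T at the a + 1 top nodes (the root and the nodes with l(u) > t)
    shows S_t = t a + E, where E is the sum of the depths of the leaves in a
    forest of at most (a + 1)(b - 1) + 2 trees. Kraft's inequality, linearised
    at a depth k, bounds E from below, and the defect in this bound is a sum of
    local nonnegative slacks. In G, cut at any a + 1 top nodes, the total slack
    is less than b - 1 for a suitable k; by integrality E is then minimal, and
    S_t(G) <= S_t(T). If T is optimal, equality holds for all t <= L/2, hence
    every such forest of T has total slack less than b - 1 too. This forces the
    leaves onto two consecutive levels, and at most one node per level whose
    subtree is neither completely filled nor empty on the last level.

    Equality for t = 1 also gives |T| = |G|, from which a node that is central
    with respect to the nodes is central with respect to the leaves. *)

(** * Rooted trees given by a parent map and a level function *)

Record ptree (V : finType) (e : rel V) (root : V) (par : V -> V)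
    (lvl : V -> nat) : Prop := Ptree {
  lvl_root : lvl root = 0;
  lvl_par : forall x, x != root -> lvl x = (lvl (par x)).+1;
  ptree_edge : forall x y,
    e x y = (x != root) && (par x == y) || (y != root) && (par y == x) }.

Section Ptree.

Variables (V : finType) (e : rel V) (root : V) (par : V -> V) (lvl : V -> nat).
Hypothesis T : ptree e root par lvl.

(* [u] is [w] or an ancestor of [w]. *)
Definition anc (u w : V) : bool :=
  (lvl u <= lvl w) && (iter (lvl w - lvl u) par w == u).

Definition kids (x : V) : {set V} := [set y | (y != root) && (par y == x)].

Definition childless (x : V) : bool := kids x == set0.

(** Counts childless nodes rather than [leaves]: a root of degree one is a leaf of the graph but has
    a child. Once the root has two children both notions agree. *)
Definition lf (u : V) : nat := \sum_(w | childless w) anc u w.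

Lemma lvl_eq0 x : (lvl x == 0) = (x == root).
Proof.
apply/eqP/eqP => [h|->]; last exact: lvl_root T.
by apply/eqP/negPn/negP => /(lvl_par T); rewrite h.
Qed.

Lemma lvl_gt0 x : (0 < lvl x) = (x != root).
Proof. by rewrite lt0n lvl_eq0. Qed.

Lemma lvl_kid x y : y \in kids x -> lvl y = (lvl x).+1.
Proof. by rewrite inE => /andP[yr /eqP <-]; exact: lvl_par T _ yr. Qed.

Lemma anc_refl x : anc x x.
Proof. by rewrite /anc leqnn subnn /= eqxx. Qed.

Lemma anc_lvl u w : anc u w -> lvl u <= lvl w.
Proof. by case/andP. Qed.

Lemma ancE u w : anc u w = (u == w) || (w != root) && anc u (par w).
Proof.
case: (eqVneq u w) => [->|uw] /=; first exact: anc_refl.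
case: (eqVneq w root) => [wr|wr] /=.
  rewrite /anc wr (lvl_root T) leqn0 lvl_eq0; apply/negP => /andP[/eqP ur _].
  by rewrite ur wr eqxx in uw.
rewrite /anc (lvl_par T wr).
case: (ltngtP (lvl u) (lvl (par w)).+1) => h.
- have -> : lvl u <= lvl (par w) by [].
  by rewrite subSn // iterSr.
- by rewrite leqNgt (leq_trans _ h).
- by rewrite h subnn /= eq_sym (negPf uw) ltnn.
Qed.

Lemma lvl_ind (P : V -> Prop) :
  P root -> (forall x, x != root -> P (par x) -> P x) -> forall x, P x.
Proof.
move=> P0 PS x; have [n] := ubnP (lvl x); elim: n x => // n IH x lx.
case: (eqVneq x root) => [->//|xr]; apply: PS => //; apply: IH.
by move: lx; rewrite (lvl_par T xr).
Qed.

Lemma anc_root w : anc root w.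
Proof.
elim/lvl_ind: w => [|w wr IH]; first exact: anc_refl.
by rewrite ancE wr IH orbT.
Qed.

Lemma anc_of_root u : anc u root = (u == root).
Proof. by rewrite ancE eqxx orbF. Qed.

Lemma ancEn u w : w != root -> anc u w = (u == w) + anc u (par w) :> nat.
Proof.
move=> wr; rewrite ancE wr /=; case: eqP => //= ->.
by rewrite /anc (lvl_par T wr) ltnn.
Qed.

Lemma anc_kid x y : y \in kids x -> anc x y.
Proof.
by rewrite inE => /andP[yr /eqP <-]; rewrite ancE yr anc_refl orbT.
Qed.

Lemma anc_trans u x w : anc u x -> anc x w -> anc u w.
Proof.
move=> ux; elim/lvl_ind: w => [|w wr IH].
  by rewrite anc_of_root => /eqP <-.
rewrite (ancE x) wr /= => /orP[/eqP <- //|/IH h].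
by rewrite ancE wr h orbT.
Qed.

Lemma anc_same_lvl u w : lvl u = lvl w -> anc u w = (u == w).
Proof. by move=> h; rewrite /anc h leqnn subnn /= eq_sym. Qed.

Lemma anc_par_r u w : anc u w -> u != w -> anc u (par w).
Proof. by rewrite ancE => /orP[/eqP ->|/andP[]//]; rewrite eqxx. Qed.

(** Exactly one child of a proper ancestor [u] of [w] is again an ancestor of [w]. The sum form
    turns into the recursion for [lf] by exchanging sums. *)
Lemma anc_kids u w : anc u w = (u == w) + \sum_(y in kids u) anc y w :> nat.
Proof.
elim/lvl_ind: w => [|w wr IH].
  rewrite anc_of_root big1 ?addn0 // => y; rewrite inE => /andP[yr _].
  by rewrite anc_of_root (negPf yr).
rewrite ancEn // IH; congr (_ + _).
rewrite [RHS](eq_bigr (fun y => (y == w) + anc y (par w))); last first.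
  by move=> y _; rewrite ancEn.
rewrite big_split /=; congr (_ + _).
case: (boolP (w \in kids u)) => wu.
  rewrite (bigD1 w) //= eqxx big1 ?addn0 => [|y /andP[_ /negPf ->]] //.
  by move: wu; rewrite inE (eq_sym u) => /andP[_ ->].
rewrite big1 => [|y yu]; last by case: eqP => // yw; rewrite -yw yu in wu.
by move: wu; rewrite inE wr (eq_sym u) /= => /negPf ->.
Qed.

Lemma lf_kids u : lf u = childless u + \sum_(y in kids u) lf y.
Proof.
rewrite /lf (eq_bigr (fun w => (u == w) + \sum_(y in kids u) anc y w));
  last first.
  by move=> w _; exact: anc_kids.
rewrite big_split /= exchange_big; congr (_ + _).
rewrite -big_mkcondl /= sum1dep_card.
case: (boolP (childless u)) => hu.
  have -> : [set w | (u == w) && childless w] = [set u].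
    by apply/setP => w; rewrite !inE eq_sym; case: eqP => // ->.
  by rewrite cards1.
apply/eqP; rewrite cards_eq0; apply/eqP/setP => w; rewrite !inE.
by case: eqP => // <-; rewrite (negPf hu).
Qed.

Lemma lf_gt0 u : 0 < lf u.
Proof.
(* Induction runs upwards from the deepest level, so the children of [u] are covered before [u]. *)
have [n] := ubnP (\max_x lvl x - lvl u); elim: n u => // n IH u hu.
rewrite lf_kids; case: (boolP (childless u)) => // /set0Pn[y yu].
rewrite (bigD1 y) //= addn_gt0; apply/orP; right; rewrite addn_gt0.
apply/orP; left; apply: IH; rewrite (lvl_kid yu).
have := leq_bigmax (F := lvl) y; rewrite (lvl_kid yu); lia.
Qed.

Lemma lf_childless u : childless u -> lf u = 1.
Proof.
move=> hu; rewrite lf_kids hu; move/eqP: hu => ->.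
by rewrite big_set0.
Qed.

Lemma lf_kids_internal u : ~~ childless u -> lf u = \sum_(y in kids u) lf y.
Proof. by move=> hu; rewrite lf_kids (negPf hu). Qed.

Lemma lf_anc u w : anc u w -> lf w <= lf u.
Proof.
move=> h; apply: leq_sum => x _; case: (boolP (anc w x)) => // wx.
by rewrite (anc_trans h wx).
Qed.

Lemma childless_below x : exists2 y, anc x y & childless y.
Proof.
have := lf_gt0 x; rewrite lt0n sum_nat_eq0 negb_forall => /existsP[y].
rewrite negb_imply => /andP[hy]; case: (boolP (anc x y)) => // xy _.
by exists y.
Qed.

Lemma lf_root : lf root = #|[set x | childless x]|.
Proof. by rewrite /lf -sum1dep_card; apply: eq_bigr => w _;
  rewrite anc_root. Qed.

Lemma lf_le_root u : lf u <= lf root.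
Proof. exact: lf_anc (anc_root u). Qed.

Lemma sum_over_kids (F : V -> nat) (P : pred V) :
  \sum_(w | (w != root) && P w) F w = \sum_x \sum_(w in kids x | P w) F w.
Proof.
rewrite (partition_big par xpredT) //=; apply: eq_bigr => x _.
by apply: eq_bigl => w; rewrite inE andbAC.
Qed.

Lemma ptree_symmetric : symmetric e.
Proof. by move=> x y; rewrite !(ptree_edge T) orbC. Qed.

Lemma neq_par x : x != root -> par x != x.
Proof. by move=> xr; apply: contra_eq_neq (lvl_par T xr) => ->; lia. Qed.

Lemma edge_par x : x != root -> e x (par x).
Proof. by move=> xr; rewrite (ptree_edge T) xr eqxx. Qed.

Lemma edge_lvl x y : e x y -> lvl y <= lvl x -> x != root /\ par x = y.
Proof.
rewrite (ptree_edge T) => /orP[/andP[xr /eqP <-]//|/andP[yr /eqP <-]].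
by rewrite (lvl_par T yr) ltnn.
Qed.

Lemma connect_root x : connect e x root.
Proof.
elim/lvl_ind: x => [|x xr IH]; first exact: connect0.
exact: connect_trans (connect1 (edge_par xr)) IH.
Qed.

(** Both cyclic neighbours of a node of greatest level are its parent, so a third distinct node is
    impossible. *)
Lemma ptree_acyclic (c : seq V) : ucycle e c -> size c <= 2.
Proof.
case: c => // x0 c0 /andP[cyc unq]; set c := x0 :: c0 in cyc unq *.
have [x xc xmax] : exists2 x, x \in c & forall y, y \in c -> lvl y <= lvl x.
  have h0 : x0 \in c by rewrite mem_head.
  by case: (arg_maxnP (P := fun x => x \in c) lvl h0) => x xc h; exists x.
have [n p cE] := rot_to xc.
have {}xmax y : y \in x :: p -> lvl y <= lvl x.
  by rewrite -cE mem_rot; apply: xmax.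
rewrite -(size_rot n) cE; rewrite -(rot_cycle n) cE in cyc.
rewrite -(rot_uniq n) cE in unq.
case/lastP: p cE cyc unq xmax => [//|p z] _ /=.
rewrite rcons_path last_rcons => /andP[hp zx] /andP[_ unq] xmax.
have [_ pz] : x != root /\ par x = z.
  apply: edge_lvl; first by rewrite ptree_symmetric.
  by apply: xmax; rewrite inE mem_rcons mem_head orbT.
case: p hp unq xmax => // y p /= /andP[xy _] /andP[yp _] xmax.
have [_ py] : x != root /\ par x = y.
  by apply: edge_lvl => //; apply: xmax; rewrite inE mem_head orbT.
by rewrite -py pz mem_rcons mem_head in yp.
Qed.

Lemma ptree_is_tree : is_tree e.
Proof.
split.
- exact: ptree_symmetric.
- move=> x; apply/negbTE/negP => h.
  by have [xr px] := edge_lvl h (leqnn _); have := neq_par xr; rewrite px eqxx.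
- by apply/card_gt0P; exists root.
- move=> x y; apply: connect_trans (connect_root x) _.
  by rewrite (sym_connect_sym ptree_symmetric); apply: connect_root.
- exact: ptree_acyclic.
Qed.

End Ptree.

(** * Path distance and sigma_LL through the edges that separate two nodes *)

Section PtreeDistance.

Variables (V : finType) (e : rel V) (root : V) (par : V -> V) (lvl : V -> nat).
Hypothesis T : ptree e root par lvl.

Local Notation anc := (anc par lvl).
Local Notation kids := (kids root par).
Local Notation childless := (childless root par).
Local Notation lf := (lf root par lvl).

(** Each [u] stands for the edge to its parent; that edge separates [x] from [y] when exactly one of
    them is below [u]. The count is the path distance. *)
Definition sep (x y : V) : nat := \sum_(u | u != root) (anc u x (+) anc u y).

Lemma sepC x y : sep x y = sep y x.
Proof. by apply: eq_bigr => u _; rewrite addbC. Qed.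

Lemma sepxx x : sep x x = 0.
Proof. by rewrite /sep big1 // => u _; rewrite addbb. Qed.

(** Replacing [x] by its parent changes the summand of [x] alone. *)
Lemma sep_par x y : x != root ->
  sep x y + anc x y = sep (par x) y + ~~ anc x y.
Proof.
move=> xr; rewrite /sep (bigD1 x) //= [in RHS](bigD1 x) //=.
rewrite (anc_refl par lvl x).
have -> : anc x (par x) = false.
  by apply/negbTE/negP => /anc_lvl; rewrite (lvl_par T xr) ltnn.
rewrite (eq_bigr (fun u => (anc u (par x) (+) anc u y : nat))); last first.
  by move=> u /andP[_ /negPf ux]; rewrite (ancE T u x) ux xr.
by case: (anc x y) => /=; lia.
Qed.

Lemma sep_edge x y z : e x y -> sep x z <= (sep y z).+1.
Proof.
rewrite (ptree_edge T) => /orP[] /andP[hr /eqP <-];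
  by have := sep_par z hr; case: (anc _ z) => /=; lia.
Qed.

Lemma sep_path x p : path e x p -> sep x (last x p) <= size p.
Proof.
elim: p x => [|y p IH] x /=; first by rewrite sepxx.
by case/andP => /(sep_edge (last y p)) h /IH; lia.
Qed.

Lemma sep_eq0 x y : (sep x y == 0) = (x == y).
Proof.
apply/eqP/eqP => [|->]; last exact: sepxx.
move=> h; have h1 : forall u, u != root -> anc u x = anc u y.
  move=> u ur; have/eqP := h; rewrite /sep sum_nat_eq0 => /forallP/(_ u).
  by rewrite ur; case: (anc u x) (anc u y) => [] [].
have xy : anc x y.
  by case: (eqVneq x root) => [->|xr];
    [exact: anc_root T _|rewrite -h1 // anc_refl].
have yx : anc y x.
  by case: (eqVneq y root) => [->|yr];
    [exact: anc_root T _|rewrite h1 // anc_refl].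
by apply/eqP; rewrite -(@anc_same_lvl _ par lvl) //; move/anc_lvl: xy;
  move/anc_lvl: yx; lia.
Qed.

(** If [x] is an ancestor of [y], the end [y] is moved to its parent, otherwise the end [x]; either
    move lowers [sep] by one. *)
Lemma sep_walk x y : exists p, [/\ path e x p, last x p = y & size p = sep x y].
Proof.
move hn: (sep x y) => n; elim: n x y hn => [|n IH] x y hn.
  by exists [::]; split => //=; apply/eqP; rewrite -sep_eq0 hn.
case: (boolP (anc x y)) => xy.
  have yr : y != root.
    apply/eqP => yr; move: xy; rewrite yr (anc_of_root T) => /eqP xr.
    by rewrite yr xr sepxx in hn.
  have yx : ~~ anc y x.
    apply/negP => yx; have /eqP : sep x y = 0; last by rewrite hn.
    apply/eqP; rewrite sep_eq0 -(@anc_same_lvl _ par lvl) //.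
    by move/anc_lvl: xy; move/anc_lvl: yx; lia.
  have := sep_par x yr; rewrite (negPf yx) sepC hn /= => h.
  have [|p [h1 h2 h3]] := IH x (par y); first by rewrite sepC; lia.
  exists (rcons p y); rewrite rcons_path h1 last_rcons size_rcons h2 h3.
  by split => //=; rewrite (ptree_symmetric T) (edge_par T yr).
have xr : x != root by apply: contraNneq xy => ->; exact: anc_root T _.
have := sep_par y xr; rewrite (negPf xy) hn /= => h.
have [|p [h1 h2 h3]] := IH (par x) y; first lia.
by exists (par x :: p); split; rewrite /= ?h1 ?h3 // (edge_par T xr).
Qed.

Lemma find_iota (a : pred nat) n N : n < N -> a n ->
  (forall m, m < n -> ~~ a m) -> find a (iota 0 N) = n.
Proof.
move=> nN an hn; have -> : N = n + (N - n.+1).+1 by lia.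
rewrite iotaD find_cat ifF /= ?add0n ?an ?addn0 ?size_iota //.
by apply/hasPn => m; rewrite mem_iota add0n; apply: hn.
Qed.

(** [sep] is at most the number of nodes other than the root, hence inside the search range of
    [dist]. No walk is shorter, since an edge changes [sep] by at most one. *)
Lemma dist_sep x y : dist e x y = sep x y.
Proof.
apply: find_iota.
- rewrite (cardD1 root) inE add1n ltnS /sep.
  apply: leq_trans (_ : \sum_(u | u != root) 1 <= _).
    by apply: leq_sum => u _; case: (_ (+) _).
  rewrite sum1_card; apply: subset_leq_card; apply/subsetP => u.
  by rewrite !inE andbT.
- have [p [h1 h2 h3]] := sep_walk x y.
  by apply/existsP; exists (tcast h3 (in_tuple p));
    rewrite val_tcast /= h1 h2 eqxx.
- move=> m hm; apply/existsP => -[p /andP[h1 /eqP h2]].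
  by have := sep_path h1; rewrite h2 size_tuple; lia.
Qed.

Lemma sum_anc_lvl x : \sum_(u | u != root) anc u x = lvl x.
Proof.
elim/(lvl_ind T): x => [|x xr IH].
  rewrite (lvl_root T) big1 // => u ur.
  by rewrite (anc_of_root T) (negPf ur).
rewrite (eq_bigr (fun u => (u == x) + anc u (par x))) => [|u _]; last first.
  by rewrite (ancEn T).
rewrite big_split /= IH (lvl_par T xr) (bigD1 x) //= eqxx big1 //.
by move=> u /andP[_ /negPf ->].
Qed.

Lemma level_lvl x : level e root x = lvl x.
Proof.
rewrite /level dist_sep -[RHS]sum_anc_lvl; apply: eq_bigr => u ur.
by rewrite (anc_of_root T) (negPf ur).
Qed.

Lemma children_kids x : children e root x = kids x.
Proof.
apply/setP => y; rewrite !inE !level_lvl (ptree_edge T).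
case: (eqVneq y root) => [->|yr] /=.
  by rewrite (lvl_root T) andbF.
rewrite (lvl_par T yr) eqSS; case: (eqVneq (par y) x) => [->|h].
  by rewrite orbT eqxx.
rewrite orbF; apply/negP => /andP[/andP[xr /eqP yE] /eqP hl].
by move: (lvl_par T xr) (lvl_par T yr); rewrite yE; lia.
Qed.

Lemma degree_kids x : degree e x = #|kids x| + (x != root).
Proof.
rewrite /degree; case: (eqVneq x root) => [->|xr] /=.
  rewrite addn0; apply: eq_card => y; rewrite !inE (ptree_edge T) eqxx.
  by [].
have pk : par x \notin kids x.
  by apply/negP => /(lvl_kid T); rewrite (lvl_par T xr); lia.
have -> : [set y | e x y] = par x |: kids x.
  by apply/setP => y; rewrite !inE (ptree_edge T) xr (eq_sym (par x)).
by rewrite cardsU1 pk addnC.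
Qed.

Lemma leaves_childless : 1 < #|kids root| ->
  leaves e = [set x | childless x].
Proof.
move=> hr; apply/setP => x; rewrite !inE degree_kids /childless -cards_eq0.
case: (eqVneq x root) => [->|xr] /=; first by rewrite addn0; lia.
by rewrite addn1 eqSS.
Qed.

Lemma sum_pairs_half (A : {set V}) (g : V -> V -> nat) :
  (forall x y, g x y = g y x) -> (forall x, g x x = 0) ->
  \sum_(x in A) \sum_(y in A) g x y =
  2 * \sum_(x in A) \sum_(y in A | enum_rank x < enum_rank y) g x y.
Proof.
move=> gC g0; rewrite mul2n -addnn.
have swap : \sum_(x in A) \sum_(y in A | enum_rank x < enum_rank y) g x y =
            \sum_(y in A) \sum_(x in A | enum_rank x < enum_rank y) g x y.
  rewrite (exchange_big_dep (fun y => y \in A)) /=;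
    last by move=> x y _ /andP[].
  by apply: eq_bigr => y yA; apply: eq_bigl => x; rewrite yA.
rewrite {2}swap -big_split /=; apply: eq_bigr => x xA.
rewrite (bigID (fun y => enum_rank x < enum_rank y)) /=; congr (_ + _).
rewrite (bigID (fun y => y == x)) /= big1 ?add0n => [|y /andP[_ /eqP ->]];
  last exact: g0.
rewrite (eq_bigr (fun y => g y x)) => [|y _]; last exact: gC.
apply: eq_bigl => y; case: (y \in A) => //=; rewrite -?andbA.
have -> : (y == x) = (enum_rank y == enum_rank x :> nat).
  by rewrite val_eqE (inj_eq enum_rank_inj).
by case: ltngtP.
Qed.

(** The edge above [u] lies on the paths of exactly [lf u * (L - lf u)] pairs of leaves. The count
    is made over ordered pairs and halved. *)
Lemma sigma_LL_lf : 1 < #|kids root| ->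
  sigma_LL e = \sum_(u | u != root) lf u * (lf root - lf u).
Proof.
move=> hr; apply/eqP; rewrite -(eqn_pmul2l (isT : 0 < 2)).
rewrite /sigma_LL -sum_pairs_half; last first.
- by move=> x; rewrite dist_sep sepxx.
- by move=> x y; rewrite !dist_sep sepC.
rewrite (leaves_childless hr).
have E (F : V -> nat) : \sum_(x in [set x | childless x]) F x = \sum_(x | childless x) F x.
  by apply: eq_bigl => x; rewrite inE.
rewrite E.
under eq_bigr => x _ do (rewrite E; under eq_bigr => y _ do rewrite dist_sep).
rewrite /sep; under eq_bigr => x _ do rewrite exchange_big.
rewrite exchange_big /= big_distrr /=; apply/eqP; apply: eq_bigr => u _.
(* For a fixed leaf [x], the edge above [u] separates it from all leaves not below [u] if [x] is
   below [u], and from the [lf u] leaves below [u] otherwise. *)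
rewrite (eq_bigr (fun x => anc u x * (lf root - lf u) + (1 - anc u x) * lf u));
  last first.
  move=> x _; have h : lf root = \sum_(y | childless y) ~~ anc u y + lf u.
    rewrite (lf_root T) -sum1dep_card /lf -big_split /=; apply: eq_bigr => y _.
    by case: (anc u y).
  case: (anc u x) => /=; last by rewrite mul1n mul0n add0n.
  by rewrite subnn mul0n addn0 mul1n h addnK.
rewrite big_split /= -!big_distrl /=.
have -> : \sum_(x | childless x) (1 - anc u x) = lf root - lf u.
  rewrite (lf_root T) -sum1dep_card /lf -sumnB //.
  by move=> x _; case: (anc u x).
by rewrite -/(lf u); lia.
Qed.

End PtreeDistance.

(** * Kraft's inequality with its defect split into local slacks *)

Section Slack.

Variables (V : finType) (e : rel V) (root : V) (par : V -> V) (lvl : V -> nat).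
Hypothesis T : ptree e root par lvl.
Variable b : nat.
Hypothesis b2 : 2 <= b.

Local Notation anc := (anc par lvl).
Local Notation kids := (kids root par).
Local Notation childless := (childless root par).
Local Notation lf := (lf root par lvl).

(** This is maximum degree at most [b.+1]; the root, having no parent, may have one more child. *)
Definition arity_le : Prop := forall x, #|kids x| <= b + (x == root).

(* The nodes cut off at the top. *)
Definition core (B : {set V}) : Prop :=
  [/\ root \in B, (forall x, x \in B -> x != root -> par x \in B)
    & (forall x, x \in B -> ~~ childless x)].

(** Depth in the forest left after removing [B], where the top node of each remaining tree has depth
    1. *)
Definition bdepth (B : {set V}) (w : V) : nat := \sum_(u | u \notin B) anc u w.

(** The quantity [E] of the overview: counted by leaves instead of nodes it is the sum of their
    [bdepth]. *)
Definition below_sum (B : {set V}) : nat := \sum_(u | u \notin B) lf u.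

(* Kraft weights [b ^ (k.+1 - d)], cut off at depth [k.+1] to stay in [nat]. *)
Definition weight (k d : nat) : nat := if d <= k.+1 then b ^ (k.+1 - d) else 0.

(* The local defects in [slack_identity]. None of the subtractions truncates when
   the arities are at most [b] ([b.+1] at the root). *)
Definition slack (B : {set V}) (k : nat) (x : V) : nat :=
  if x \in B then (b + (x == root) - #|kids x|) * b ^ k
  else if childless x
    then weight k (bdepth B x) + b.-1 * bdepth B x - (1 + b.-1 * k.+1)
  else weight k (bdepth B x) - #|kids x| * weight k (bdepth B x).+1.

Lemma weight_step k d : b * weight k d.+1 <= weight k d.
Proof.
rewrite /weight; case: ifP => h.
  have -> : d <= k.+1 by lia.
  have -> : k.+1 - d = (k.+1 - d.+1).+1 by lia.
  by rewrite expnS.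
by rewrite muln0.
Qed.

Lemma bernoulli n : 1 + b.-1 * n <= b ^ n.
Proof.
elim: n => [|n IH]; first by rewrite muln0.
rewrite expnS;
  have : b * (1 + b.-1 * n) <= b * b ^ n by rewrite leq_mul2l IH orbT.
have : exists c, b = c.+2 by exists (b - 2); lia.
by case=> c ->; rewrite /=; nia.
Qed.

(** The surplus [b.-1] is more than a total slack of [b - 2] can pay for, so no leaf lies two or
    more steps above depth [k.+1]. *)
Lemma bernoulli_strict n : 2 <= n -> 1 + b.-1 * n + b.-1 <= b ^ n.
Proof.
case: n => [//|[//|n _]].
have h := bernoulli n.+1; rewrite expnS.
have h2 : b * (1 + b.-1 * n.+1) <= b * b ^ n.+1 by rewrite leq_mul2l h orbT.
apply: leq_trans h2.
have : exists c, b = c.+2 by exists (b - 2); lia.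
by case=> c ->; rewrite /=; nia.
Qed.

(** The linearisation: the weight lies above the line that meets it at the depths [k] and [k.+1]. *)
Lemma weight_leaf k d : 1 + b.-1 * k.+1 <= weight k d + b.-1 * d.
Proof.
rewrite /weight; case: ifP => h.
  have := bernoulli (k.+1 - d); have -> : k.+1 = (k.+1 - d) + d by lia.
  by rewrite mulnDr addnK; lia.
have -> : d = k.+1 + (d - k.+1) by lia.
rewrite mulnDr; have : 1 <= b.-1 * (d - k.+1) by rewrite muln_gt0; lia.
lia.
Qed.

Section Core.

Variable B : {set V}.
Hypothesis HB : core B.

Lemma bdepth_root : bdepth B root = 0.
Proof.
case: HB => rB _ _; rewrite /bdepth big1 // => u uB; rewrite (anc_of_root T).
by case: eqP => // ur; rewrite ur rB in uB.
Qed.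

Lemma bdepth_par w : w != root -> bdepth B w = (w \notin B) + bdepth B (par w).
Proof.
move=> wr; rewrite /bdepth.
rewrite (eq_bigr (fun u => (u == w) + anc u (par w))) => [|u _]; last first.
  by rewrite (ancEn T).
rewrite big_split /=; congr (_ + _).
case: (boolP (w \in B)) => wB /=.
  by rewrite big1 // => u uB; case: eqP => // uw; rewrite uw wB in uB.
by rewrite (bigD1 w) //= eqxx big1 // => u /andP[_ /negPf ->].
Qed.

Lemma bdepth_in w : w \in B -> bdepth B w = 0.
Proof.
case: HB => rB uB _; elim/(lvl_ind T): w => [_|w wr IH wB];
  first exact: bdepth_root.
by rewrite bdepth_par // wB IH // uB.
Qed.

Lemma bdepth_kid x w : w \in kids x -> w \notin B -> bdepth B w = (bdepth B x).+1.
Proof.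
by rewrite inE => /andP[wr /eqP <-] wB; rewrite bdepth_par // wB.
Qed.

Lemma bdepth_anc u w : anc u w -> bdepth B u <= bdepth B w.
Proof.
by move=> uw; apply: leq_sum => x _;
  case: (boolP (anc x u)) => // /(anc_trans T)/(_ uw) ->.
Qed.

Lemma core_kid x w : w \in kids x -> w \in B -> x \in B.
Proof. by case: HB => _ h _; rewrite inE => /andP[wr /eqP <-] wB; apply: h. Qed.

Lemma notin_core_neq_root x : x \notin B -> x != root.
Proof. by case: HB => rB _ _; apply: contraNneq => ->. Qed.

Lemma below_sum_childless : below_sum B = \sum_(x | childless x) bdepth B x.
Proof. by rewrite /below_sum /lf exchange_big. Qed.

Lemma childless_notin_core x : childless x -> x \notin B.
Proof. by case: HB => _ _ h hx; apply/negP => /h; rewrite hx. Qed.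

Lemma card_core : \sum_(x in B) #|[set w in kids x | w \in B]| = #|B|.-1.
Proof.
case: HB => rB uB _.
have -> : #|B|.-1 = \sum_(w | (w != root) && (w \in B)) 1.
  rewrite sum1_card (cardD1 root) rB /=.
  by apply: eq_card => x; rewrite !inE.
rewrite (sum_over_kids root par) [RHS](bigID (mem B)) /= [X in _ = _ + X]big1 ?addn0.
  apply: eq_bigr => x xB; rewrite -sum1_card; apply: eq_bigl => w.
  by rewrite !inE.
move=> x xB; rewrite big1 // => w /andP[wx wB].
by rewrite (core_kid wx wB) in xB.
Qed.

(** The nodes outside [B] are sorted by parent. The [#|B|.-1] nodes of [B] below the root are
    children too and are added on the left, which avoids a subtraction. *)
Lemma sum_bdepth_weight (F : nat -> nat) :
  \sum_(w | w \notin B) F (bdepth B w) + #|B|.-1 * F 1 =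
  (\sum_(x in B) #|kids x|) * F 1 + \sum_(x | x \notin B) #|kids x| * F (bdepth B x).+1.
Proof.
have -> : \sum_(w | w \notin B) F (bdepth B w) =
          \sum_(w | (w != root) && (w \notin B)) F (bdepth B w).
  apply: eq_bigl => w; case: (boolP (w \notin B)) => h; last by rewrite andbF.
  by rewrite (notin_core_neq_root h).
rewrite (sum_over_kids root par) (bigID (mem B)) /= addnAC; congr (_ + _).
  rewrite -card_core !big_distrl /= -big_split /=; apply: eq_bigr => x xB.
  rewrite (eq_bigr (fun=> F 1)) => [|w /andP[wx wB]]; last first.
    by rewrite (bdepth_kid wx wB) bdepth_in.
  rewrite sum_nat_cond_const -mulnDl; congr (_ * _).
  rewrite -(cardsID B (kids x)) addnC; congr (_ + _).
  by apply: eq_card => w; rewrite !inE andbC.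
apply: eq_bigr => x xB.
rewrite (eq_bigl (fun w => w \in kids x)) => [|w]; last first.
  case: (boolP (w \in kids x)) => //= wx; apply/negP => wB.
  by rewrite (core_kid wx wB) in xB.
rewrite -sum_nat_const; apply: eq_bigr => w wx; rewrite (bdepth_kid wx) //.
by apply/negP => wB; rewrite (core_kid wx wB) in xB.
Qed.

Hypothesis Har : arity_le.

(** The slack of core nodes measures missing children, that of leaves the linearisation, that of the
    other nodes the loss in Kraft's inequality. In their sum all weights cancel, so for given
    [#|B|], [k] and number of leaves the total slack determines [below_sum B]. *)
Lemma slack_identity k :
  b.-1 * below_sum B + (#|B| * b.-1 + 2) * b ^ k =
  (b.-1 * k + b) * lf root + \sum_x slack B k x.
Proof.
case: (HB) => rB uB nlB.
have B0 : 0 < #|B| by apply/card_gt0P; exists root.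
rewrite (bigID (mem B)) /= [X in _ = _ + (_ + X)](bigID childless) /=.
have h1 : \sum_(x in B) slack B k x + (\sum_(x in B) #|kids x|) * b ^ k =
          (#|B| * b + 1) * b ^ k.
  rewrite big_distrl -big_split /=.
  rewrite (eq_bigr (fun x => (b + (x == root)) * b ^ k)) => [|x xB]; last first.
    by rewrite /slack xB -mulnDl subnK // Har.
  rewrite -big_distrl /= big_split /= sum_nat_const; congr ((_ + _) * _).
  by rewrite (bigD1 root) //= eqxx big1 // => x /andP[_ /negPf ->].
have h2 : \sum_(x | (x \notin B) && childless x) slack B k x +
    lf root * (1 + b.-1 * k.+1) =
    \sum_(x | (x \notin B) && childless x) weight k (bdepth B x) +
    b.-1 * below_sum B.
  rewrite below_sum_childless (lf_root T) -sum1dep_card big_distrl big_distrr /=.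
  have E (F : V -> nat) : \sum_(x | childless x) F x =
      \sum_(x | (x \notin B) && childless x) F x.
    apply: eq_bigl => x; case: (boolP (childless x)) => h;
      last by rewrite andbF.
    by rewrite childless_notin_core.
  rewrite !E -!big_split /=; apply: eq_bigr => x /andP[xB cx].
  by rewrite /slack (negPf xB) cx mul1n subnK // weight_leaf.
have h3 : \sum_(x | (x \notin B) && ~~ childless x) slack B k x +
    \sum_(x | x \notin B) #|kids x| * weight k (bdepth B x).+1 =
    \sum_(x | (x \notin B) && ~~ childless x) weight k (bdepth B x).
  rewrite [X in _ + X](bigID childless) /= [X in _ + (X + _)]big1 ?add0n.
    rewrite -big_split /=; apply: eq_bigr => x /andP[xB cx].
    rewrite /slack (negPf xB) (negPf cx) subnK //.
    apply: leq_trans (weight_step _ _); rewrite leq_mul2r; apply/orP; right.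
    by have := Har x; rewrite (negPf (notin_core_neq_root xB)) addn0.
  by move=> x /andP[_ /eqP ->]; rewrite cards0.
have := sum_bdepth_weight (weight k).
have -> : weight k 1 = b ^ k by rewrite /weight /= subn1.
rewrite (bigID childless) /= => h4.
have [c bE] : exists c, b = c.+2 by exists (b - 2); lia.
have [d BE] : exists d, #|B| = d.+1 by exists #|B|.-1; lia.
rewrite BE bE /= -bE in h1 h2 h3 h4 *.
move: h1 h2 h3 h4.
set P := b ^ k.
set s1 := \sum_(x in B) slack B k x;
  set s2 := \sum_(x | _ && childless x) slack _ _ _.
set s3 := \sum_(x | _) slack _ _ _.
set n1 := \sum_(x in B) _; set w1 := \sum_(x | _) weight _ _;
  set w2 := \sum_(x | _) weight _ _.
set q := \sum_(x | _ ) _ * _; set EB := below_sum B; set L := lf root.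
move: P s1 s2 s3 n1 w1 w2 q EB L => P s1 s2 s3 n1 w1 w2 q EB L.
rewrite bE => h1 h2 h3 h4; nia.
Qed.

(** A leaf above depth [k] costs at least [b.-1]. A leaf at depth [k.+2] costs only [b - 2], but its
    parent then has weight 1 and children of weight 0, which costs 1 more. Deeper leaves cost too
    much by themselves. *)
Lemma slack_leaf_range k x : \sum_x slack B k x <= b - 2 -> childless x ->
  k <= bdepth B x <= k.+1.
Proof.
move=> hs cx; have xB := childless_notin_core cx.
have xr := notin_core_neq_root xB.
have hx : slack B k x <= b - 2.
  by apply: leq_trans hs; rewrite (bigD1 x) //= leq_addr.
have hxx : slack B k x + slack B k (par x) <= b - 2.
  apply: leq_trans hs; rewrite (bigD1 x) //= leq_add2l.
  by rewrite (bigD1 (par x)) ?(neq_par T xr) //= leq_addr.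
move: hx hxx; rewrite {1 2}/slack (negPf xB) cx.
rewrite /weight; case: ifP => hd.
  move=> h _; rewrite andbT leqNgt; apply/negP => dk.
  have := @bernoulli_strict (k.+1 - bdepth B x);
    have : 2 <= k.+1 - bdepth B x by lia.
  move=> -> // /(_ isT);
    have E : k.+1 = (k.+1 - bdepth B x) + bdepth B x by lia.
  by move: h; rewrite {2}E mulnDr; lia.
rewrite add0n => h1 h2.
have dE : bdepth B x = (bdepth B (par x)).+1 by rewrite bdepth_par // xB.
have pB : par x \notin B by apply/negP => /bdepth_in; lia.
have pc : ~~ childless (par x).
  by apply/negP => /eqP h; have := in_set0 x; rewrite -h inE xr eqxx.
move: h2; rewrite /slack (negPf pB) (negPf pc) /weight -dE hd muln0 subn0.
have {}hd : k.+1 < bdepth B x by lia.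
have dd : bdepth B x = k.+1 + (bdepth B x - k.+1) by lia.
rewrite dd mulnDr in h1 *.
case: ifP => hp.
  have -> : k.+1 - bdepth B (par x) = 0 by lia.
  have -> : bdepth B x - k.+1 = 1 by lia.
  rewrite expn0 muln1; lia.
move=> _; have h3 : b.-1 * 2 <= b.-1 * (bdepth B x - k.+1).
  by rewrite leq_mul2l; apply/orP; right; lia.
lia.
Qed.

(** A missing child costs a power of [b]: at least [b] above depth [k], which is too much, and 1 at
    depth [k], so there at most [b - 2] children are missing. *)
Lemma slack_internal k x : \sum_x slack B k x <= b - 2 -> x \notin B ->
  ~~ childless x ->
  [/\ bdepth B x <= k, bdepth B x < k -> #|kids x| = b & 2 <= #|kids x|].
Proof.
move=> hs xB cx; have xr := notin_core_neq_root xB.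
have hd : bdepth B x <= k.
  case/set0Pn: (cx) => w wx.
  have [y wy cy] := childless_below T w.
  have /andP[_ h] := slack_leaf_range hs cy.
  have := bdepth_anc wy; rewrite (bdepth_kid wx); first lia.
  by apply/negP => wB; rewrite (core_kid wx wB) in xB.
have hx : slack B k x <= b - 2.
  by apply: leq_trans hs; rewrite (bigD1 x) //= leq_addr.
have hk : #|kids x| <= b by have := Har x; rewrite (negPf xr) addn0.
move: hx; rewrite /slack (negPf xB) (negPf cx) /weight.
rewrite (leq_trans hd (leqnSn k)) ltnS hd subSS (subSn hd) expnS -mulnBl => hx.
split=> // [dk|].
  apply/eqP; rewrite eqn_leq hk leqNgt; apply/negP => kb.
  have : b ^ 1 <= b ^ (k - bdepth B x) by rewrite leq_exp2l; lia.
  have : 1 * b ^ (k - bdepth B x) <= (b - #|kids x|) * b ^ (k - bdepth B x).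
    by rewrite leq_mul2r; apply/orP; right; lia.
  by rewrite expn1; lia.
have : 0 < b ^ (k - bdepth B x) by rewrite expn_gt0; lia.
by nia.
Qed.

Lemma slack_core k x : \sum_x slack B k x <= b - 2 -> x \in B -> 0 < k ->
  #|kids x| = b + (x == root).
Proof.
move=> hs xB k0.
have hx : slack B k x <= b - 2.
  by apply: leq_trans hs; rewrite (bigD1 x) //= leq_addr.
move: hx; rewrite /slack xB => hx; have hk := Har x.
have : b ^ 1 <= b ^ k by rewrite leq_exp2l; lia.
rewrite expn1 => hb; nia.
Qed.

End Core.

End Slack.

(* The interface through which the comparison tree is used: cutting off its
   [j.+1] top nodes leaves a forest whose slack is less than [b.-1], so that
   its sum of leaf depths is the least possible integer. *)
Record frugal (b i L : nat) (V : finType) (e : rel V) (root : V)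
    (par : V -> V) (lvl : V -> nat) : Prop := Frugal {
  frugal_ptree : ptree e root par lvl;
  frugal_arity : arity_le root par b;
  frugal_root : 1 < #|kids root par root|;
  frugal_leaves : lf root par lvl root = L;
  frugal_card : #|V| = L + i;
  frugal_slack : forall j, j < i -> exists B k,
    [/\ core root par B, #|B| = j.+1
      & \sum_x slack root par lvl b B k x <= b - 2] }.

(** * The comparison tree, a heap in breadth-first numbering *)

Section Heap.

Variables (b i L : nat).
Hypotheses (b2 : 2 <= b) (i0 : 0 < i) (bL : b.+1 <= L).
(** Here [i] is the number of internal nodes. The lower bound on [L] leaves at least two children
    for the last of them, the upper bound keeps it within its arity. *)
Hypotheses (iL : i.-1 * b.-1 + 3 <= L) (Li : L <= i * b.-1 + 2).

Let N := (L + i).-1.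

(* Breadth-first numbering: the children of [0] are [1 .. b.+1], those of [p > 0]
   are [p * b + 2 .. p * b + b.+1]; [1 - 2 = 0] gives [1] its parent [0]. *)
Definition heap_up (p : nat) : nat := (p - 2) %/ b.

(** Parents have smaller numbers, so [p] itself is enough fuel for [p]. *)
Fixpoint heap_depth (fuel p : nat) : nat :=
  if fuel is f.+1 then if p == 0 then 0 else (heap_depth f (heap_up p)).+1 else 0.

Definition hpar (p : 'I_N.+1) : 'I_N.+1 := inord (heap_up p).

Definition hlvl (p : 'I_N.+1) : nat := heap_depth p p.

Definition hedge : rel 'I_N.+1 :=
  fun x y => (x != ord0) && (hpar x == y) || (y != ord0) && (hpar y == x).

Local Notation hkids := (kids (@ord0 N) hpar).

Lemma heap_up_lt p : 0 < p -> heap_up p < p.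
Proof. by move=> p0; apply: leq_ltn_trans (leq_div _ _) _; lia. Qed.

Lemma heap_up_mono p q : p <= q -> heap_up p <= heap_up q.
Proof. by move=> pq; apply: leq_div2r; lia. Qed.

Lemma heap_depth_fuel f g p : p <= f -> p <= g -> heap_depth f p = heap_depth g p.
Proof.
elim: f g p => [|f IH] [|g] p //=.
- by rewrite leqn0 => /eqP ->.
- by move=> _; rewrite leqn0 => /eqP ->.
case: eqP => // /eqP p0 pf pg; congr _.+1; apply: IH.
  by have := @heap_up_lt p; lia.
by have := @heap_up_lt p; lia.
Qed.

Lemma val_hpar (p : 'I_N.+1) : val (hpar p) = heap_up p.
Proof.
rewrite /= inordK //; have := ltn_ord p; case: (posnP p) => [->|/heap_up_lt];
  last lia.
by rewrite /heap_up div0n.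
Qed.

Lemma ptree_heap : ptree hedge ord0 hpar hlvl.
Proof.
split=> // x x0; rewrite /hlvl val_hpar.
have p0 : 0 < x by rewrite lt0n.
rewrite {1}(@heap_depth_fuel x (x.-1).+1 x) /=; [|lia..].
by rewrite ifF;
  [congr _.+1; apply: heap_depth_fuel; have := heap_up_lt p0; lia|lia].
Qed.

Lemma card_ord_interval m lo hi :
  #|[set q : 'I_m | lo <= q < hi]| = minn hi m - minn lo m.
Proof.
rewrite -sum1dep_card big_mkcond /=.
elim: m => [|m IH]; first by rewrite big_ord0; lia.
rewrite big_ord_recr /= IH; case: ifP; lia.
Qed.

(** The children form an interval of numbers cut off at the last node; [(0 < p)] reflects the extra
    child of the root. *)
Lemma card_hkids (p : 'I_N.+1) :
  #|hkids p| = minn (p * b + b + 2) N.+1 - minn (p * b + 1 + (0 < p)) N.+1.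
Proof.
rewrite -card_ord_interval; apply: eq_card => q;
  rewrite !inE -!val_eqE val_hpar /=.
have -> : (heap_up q == p) = (q - 2 < p * b + b) && (p * b <= q - 2).
  have bb : 0 < b by lia.
  by rewrite /heap_up eqn_leq -ltnS ltn_divLR // leq_divRL // mulSn addnC.
case: (posnP p) => p0; first by rewrite p0 mul0n; lia.
have : 0 < p * b by rewrite muln_gt0 p0; lia.
lia.
Qed.

Let iN : i.-1 * b + 3 <= N.+1.
Proof.
rewrite /N; have : i.-1 * b = i.-1 * b.-1 + i.-1 by rewrite -mulnSr prednK; lia.
lia.
Qed.

Let Ni : N.+1 <= i * b + 2.
Proof.
rewrite /N; have : i * b = i * b.-1 + i by rewrite -mulnSr prednK; lia.
lia.
Qed.

Lemma hkids_full (p : 'I_N.+1) : p < i.-1 -> #|hkids p| = b + (p == ord0).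
Proof.
move=> pi; rewrite card_hkids -val_eqE /=.
have h : p.+1 * b <= i.-1 * b by rewrite leq_mul2r pi orbT.
rewrite mulSn in h; case: (posnP p) => p0 /=; first by rewrite p0; lia.
lia.
Qed.

Lemma hkids_last (p : 'I_N.+1) : p = i.-1 :> nat ->
  2 <= #|hkids p| <= b + (p == ord0) /\ (p = ord0 -> #|hkids p| = b.+1).
Proof.
move=> pi; have := card_hkids p; rewrite -val_eqE /= pi => ->.
have h : i * b = i.-1 * b + b by rewrite -{1}(prednK i0) mulSn addnC.
split; first by lia.
move/(congr1 val); rewrite /= pi => ip.
by rewrite ip mul0n; lia.
Qed.

Lemma hkids_none (p : 'I_N.+1) : i <= p -> #|hkids p| = 0.
Proof.
move=> pi; rewrite card_hkids.
have h : i * b <= p * b by rewrite leq_mul2r pi orbT.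
lia.
Qed.

Lemma childless_heap (p : 'I_N.+1) : childless ord0 hpar p = (i <= p).
Proof.
rewrite /childless -cards_eq0; case: (leqP i p) => [/hkids_none ->//|pi].
case: (ltnP p i.-1) => [/hkids_full ->|h]; first lia.
have [|/andP[h1 _] _] := @hkids_last p; lia.
Qed.

Lemma arity_heap : arity_le ord0 hpar b.
Proof.
move=> p; case: (leqP i p) => [/hkids_none ->//|pi].
case: (ltnP p i.-1) => [/hkids_full ->//|h].
have [|/andP[_ h2] _ //] := @hkids_last p; lia.
Qed.

Lemma lf_heap_root : lf ord0 hpar hlvl ord0 = L.
Proof.
rewrite (lf_root ptree_heap).
rewrite (eq_card (B := [set q : 'I_N.+1 | i <= q < N.+1])).
  by rewrite card_ord_interval /N; lia.
by move=> p; rewrite !inE childless_heap ltn_ord andbT.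
Qed.

Definition hcore (j : nat) : {set 'I_N.+1} := [set p : 'I_N.+1 | p <= j].

Lemma core_hcore j : j < i -> core ord0 hpar (hcore j).
Proof.
move=> ji; split; rewrite ?inE // => x; rewrite !inE.
  by move=> xj x0; rewrite val_hpar; have := @heap_up_lt x;
    rewrite lt0n => /(_ x0); lia.
by rewrite childless_heap; lia.
Qed.

Lemma card_hcore j : j < i -> #|hcore j| = j.+1.
Proof.
move=> ji; rewrite (eq_card (B := [set q : 'I_N.+1 | 0 <= q < j.+1])).
  by rewrite card_ord_interval /N; lia.
by move=> p; rewrite !inE.
Qed.

(** The parent map is monotone in the numbering and [hcore j] is an initial segment. *)
Lemma bdepth_heap_mono j (p q : 'I_N.+1) : j < i -> p <= q ->
  bdepth hpar hlvl (hcore j) p <= bdepth hpar hlvl (hcore j) q.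
Proof.
move=> ji; have cj := core_hcore ji.
elim/(lvl_ind ptree_heap): q p => [|q q0 IH] p pq.
  by have -> : p = ord0 by apply: val_inj => /=; move: pq => /=; lia.
case: (eqVneq p ord0) => [->|p0]; first by rewrite (bdepth_root ptree_heap cj).
have E x : x != ord0 -> bdepth hpar hlvl (hcore j) x =
    (x \notin hcore j) + bdepth hpar hlvl (hcore j) (hpar x).
  exact: (bdepth_par ptree_heap).
rewrite (E p p0) (E q q0); apply: leq_add.
  by rewrite !inE -!ltnNge; case: (ltnP j p) => // jp;
    rewrite (leq_trans jp pq).
by apply: IH; rewrite !val_hpar heap_up_mono.
Qed.

(* [k.+1] is the largest relative depth; the only node that can carry slack is
   the last internal one, [i.-1]. *)
Lemma heap_slack j : j < i ->
  exists k, \sum_x slack ord0 hpar hlvl b (hcore j) k x <= b - 2.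
Proof.
move=> ji; have cj := core_hcore ji; pose d := bdepth hpar hlvl (hcore j).
have Nj : (ord_max : 'I_N.+1) \notin hcore j by rewrite inE /= /N; lia.
have N0 : (ord_max : 'I_N.+1) != ord0 by rewrite -val_eqE /= /N; lia.
have dN : d ord_max = (d (hpar ord_max)).+1.
  by rewrite /d (bdepth_par ptree_heap) // Nj.
have pN : val (hpar ord_max) = i.-1.
  rewrite val_hpar /heap_up /=; apply/eqP; rewrite eqn_leq.
  have -> : (N - 2) %/ b <= i.-1.
    rewrite -ltnS prednK // ltn_divLR; lia.
  by rewrite leq_divRL; lia.
(* The parent of the last node is the last internal node [i.-1]. By monotonicity its depth [k]
   bounds the depths of internal nodes from above, and all leaves lie at depth [k] or [k.+1]. *)
exists (d (hpar ord_max)); set k := d (hpar ord_max) in dN *.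
have dle (p : 'I_N.+1) : d p <= k.+1.
  by rewrite -dN; apply: bdepth_heap_mono => //=; have := ltn_ord p; lia.
have dge (p : 'I_N.+1) : i <= p -> k <= d p.
  by move=> ip; apply: bdepth_heap_mono => //; rewrite pN; lia.
have dint (p : 'I_N.+1) : p < i -> d p <= k.
  by move=> ip; apply: bdepth_heap_mono => //; rewrite pN; lia.
rewrite (bigD1 (hpar ord_max)) //= big1 ?addn0 => [|p pp].
  have [/andP[h1 h2] h3] := hkids_last pN.
  rewrite /slack; case: ifP => hB.
    have -> : k = 0 by rewrite /k /d (bdepth_in ptree_heap cj hB).
    case: eqP => [/h3|_]; lia.
  rewrite childless_heap pN ifF; last lia.
  rewrite -/d -/k /weight leqnSn leqnn subSn // !subnn expn0 expn1 muln1.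
  lia.
rewrite /slack; case: ifP => hB.
  have pi : p < i.-1.
    by move: hB; rewrite inE; move: pp; rewrite -val_eqE pN /=; lia.
  by rewrite hkids_full // subnn.
rewrite childless_heap -/d /weight; case: ifP => ip.
  rewrite dle; have := dge p ip; have := dle p.
  case: (eqVneq (d p) k) => [-> _ _|h1 h2 h3].
    by rewrite subSn // subnn expn1 mulnSr; lia.
  have -> : d p = k.+1 by lia.
  by rewrite subnn expn0; lia.
have pi : p < i.-1 by move: pp; rewrite -val_eqE pN /=; lia.
have dk : d p <= k by apply: dint; lia.
have p0 : p != ord0 by apply: contraFneq hB => ->; rewrite inE.
rewrite (leq_trans dk (leqnSn k)) ltnS dk hkids_full // (negPf p0) addn0 subSS.
by rewrite subSn // expnS subnn.
Qed.

Lemma heap_frugal : frugal b i L hedge ord0 hpar hlvl.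
Proof.
split.
- exact: ptree_heap.
- exact: arity_heap.
- case: (posnP i.-1) => h.
    by have [|_ -> //] := @hkids_last ord0; last lia.
  by rewrite hkids_full //; lia.
- exact: lf_heap_root.
- by rewrite card_ord /N; lia.
move=> j ji; have [k hk] := heap_slack ji.
by exists (hcore j), k; split; [exact: core_hcore|exact: card_hcore|].
Qed.

End Heap.

(** * Rooting an abstract tree by distance from a node *)

Lemma is_tree_ptree (V : finType) (e : rel V) (v : V) :
  is_tree e -> exists par lvl, ptree e v par lvl.
Proof.
case=> esym eirr _ econ eacyc.
have ex x : exists n, walk_of_length e v x n.
  have /connectP[p hp ->] := econ v x.
  by exists (size p); apply/existsP; exists (in_tuple p); rewrite /= hp eqxx.
pose lvl x := ex_minn (ex x).
have lvlW x : walk_of_length e v x (lvl x) by rewrite /lvl; case: ex_minnP.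
have lvl_min x n : walk_of_length e v x n -> lvl x <= n.
  by rewrite /lvl; case: ex_minnP => m _; apply.
have lvl0 x : lvl x = 0 -> x = v.
  move=> h; have := lvlW x; rewrite h => /existsP[p]; rewrite tuple0 /=.
  by move/eqP.
have lvlv : lvl v = 0.
  by apply/eqP; rewrite -leqn0; apply: lvl_min; apply/existsP; exists [tuple];
    rewrite /=.
have lvl_step x y : e x y -> lvl y <= (lvl x).+1.
  move=> xy; apply: lvl_min; have /existsP[p /andP[h1 /eqP h2]] := lvlW x.
  apply/existsP; exists [tuple of rcons p y].
  by rewrite /= rcons_path h1 h2 xy last_rcons eqxx.
have down x : x != v -> exists y, e x y && (lvl x == (lvl y).+1).
  move=> xv; have /existsP[p /andP[h1 /eqP h2]] := lvlW x.
  have := size_tuple p; case/lastP: {p}(val p) h1 h2 => [_ h|p z].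
    by rewrite /= in h; rewrite h eqxx in xv.
  rewrite rcons_path last_rcons size_rcons => /andP[h1 yz] zx hs.
  rewrite zx in yz; exists (last v p); rewrite esym yz /= eqn_leq lvl_step //=.
  rewrite -hs ltnS; apply: lvl_min; apply/existsP; exists (in_tuple p).
  by rewrite /= h1 eqxx.
(* The default [x] is taken only at [v], where no neighbour has a smaller level. *)
pose par x := odflt x [pick y | e x y && (lvl x == (lvl y).+1)].
have parP x : x != v -> e x (par x) && (lvl x == (lvl (par x)).+1).
  by move=> /down[y hy]; rewrite /par; case: pickP => // /(_ y); rewrite hy.
pose R x := [rel p q | [&& p != x, q != x & e p q]].
have Rsym x : connect_sym (R x).
  by apply: sym_connect_sym => p q /=; rewrite esym andbCA.
have to_v x a : a != x -> lvl a <= lvl x -> connect (R x) a v.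
  have [n] := ubnP (lvl a); elim: n a => // n IH a an ax lax.
  case: (eqVneq a v) => [->|av]; first exact: connect0.
  have [y /andP[ay /eqP hl]] := down a av.
  have yx : y != x by apply/eqP => yx; rewrite -yx in lax; lia.
  apply: connect_trans (connect1 _) (IH y _ yx _); rewrite /= ?ax ?yx //; lia.
(* The parent is unique: two neighbours of [x] on levels not above that of [x] are both connected to
   [v] in the graph without [x]. If they differed, a path between them would close to a cycle
   through [x]. *)
have uniq_up x a c : e x a -> e x c -> lvl a <= lvl x -> lvl c <= lvl x -> a = c.
  move=> xa xc la lc; apply/eqP/negPn/negP => ac.
  have neq z : e x z -> z != x by apply: contraTneq => ->; rewrite eirr.
  have : connect (R x) a c.
    apply: connect_trans (to_v x a (neq _ xa) la) _.
    by rewrite Rsym; apply: to_v => //; apply: neq.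
  case/connectP => p0 hp0 lp0; case/shortenP: hp0 lp0 => p hp unq _ cE.
  have hx : x \notin a :: p.
    rewrite inE eq_sym (negPf (neq _ xa)) /=.
    elim: p (a) hp {unq cE} => //= z p IH a' /andP[/and3P[_ zx _] /IH h].
    by rewrite inE eq_sym (negPf zx).
  have hpe : path e a p by apply: sub_path hp => p1 q /and3P[].
  have := eacyc (x :: a :: p); rewrite /ucycle.
  rewrite (_ : uniq _) ?andbT; last by rewrite cons_uniq hx.
  rewrite /= rcons_path xa hpe -cE esym xc => /(_ isT).
  case: p hp unq cE hx hpe => //= _ _ cE.
  by rewrite cE eqxx in ac.
exists par, lvl; split=> // [x /parP/andP[_ /eqP //]|x y].
have half x1 y1 : e x1 y1 -> lvl y1 <= lvl x1 -> (x1 != v) && (par x1 == y1).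
  move=> xy hl; have xv : x1 != v.
    apply/eqP => xv; rewrite xv lvlv in hl xy.
    by have /lvl0 yv : lvl y1 = 0 by [lia]; rewrite yv eirr in xy.
  have /andP[h1 /eqP h2] := parP _ xv.
  by rewrite xv (uniq_up x1 (par x1) y1) ?eqxx //; lia.
apply/idP/orP => [xy|[]/andP[/parP/andP[h _] /eqP <-] //]; last by rewrite esym.
case/orP: (leq_total (lvl y) (lvl x)) => h; [left|right]; apply: half => //.
by rewrite esym.
Qed.

(** * Paths, subtrees and components in terms of ancestors *)

Section PtreeGraph.

Variables (V : finType) (e : rel V) (root : V) (par : V -> V) (lvl : V -> nat).
Hypothesis T : ptree e root par lvl.

Local Notation anc := (anc par lvl).
Local Notation kids := (kids root par).
Local Notation childless := (childless root par).
Local Notation lf := (lf root par lvl).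

(** The only edge between the nodes below [u] and the rest joins [u] to [par u]. *)
Lemma path_enters_below u a p : ~~ anc u a -> path e a p ->
  anc u (last a p) -> par u \in a :: p.
Proof.
elim: p a => [|y p IH] a ua /=; first by rewrite (negPf ua).
case/andP=> ay hp hl; case: (boolP (anc u y)) => uy; last first.
  by rewrite inE (IH y) ?orbT.
rewrite inE; apply/orP; left; move: ay; rewrite (ptree_edge T).
case/orP=> /andP[r1 /eqP hE].
  by rewrite -hE in uy; move: ua; rewrite (ancE T) r1 uy orbT.
move: uy; rewrite (ancE T) r1 hE (negPf ua) andbF orbF => /eqP ->.
by rewrite hE.
Qed.

Lemma up_path w : exists p, [/\ path e w p, last w p = root, uniq (w :: p)
  & forall u, (u \in w :: p) = anc u w].
Proof.
elim/(lvl_ind T): w => [|w wr [p [h1 h2 h3 h4]]].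
  by exists [::]; split => // u; rewrite inE (anc_of_root T).
exists (par w :: p); rewrite /= h1 (edge_par T wr) h2; split => //.
  rewrite -cons_uniq cons_uniq h3 andbT h4; apply/negP => /anc_lvl.
  by rewrite (lvl_par T wr) ltnn.
by move=> u; rewrite inE h4 (ancE T u w) wr.
Qed.

(** If [w] is not below [u], a path from [w] through [u] to the root meets [par u] both before and
    after [u], so it is not simple. *)
Lemma subtree_anc u : u != root -> subtree e root u = [set w | anc u w].
Proof.
move=> ur; apply/setP => w; rewrite !inE; apply/existsP/idP.
  case=> n /existsP[p /and4P[hp /eqP hl unq up]].
  apply/negPn/negP => uw; case/splitPl: {p}(val p) / up hp hl unq => p1 p2 hu.
  rewrite cat_path last_cat hu => /andP[hp1 hp2] hl.
  have i1 : par u \in w :: p1.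
    by apply: (path_enters_below uw hp1); rewrite hu anc_refl.
  have i2 : par u \in p2.
    have : par u \in root :: rev (belast u p2).
      have hr : path e root (rev (belast u p2)).
        rewrite -hl (eq_path (e' := fun x y => e y x)) ?rev_path // => x y.
        exact: ptree_symmetric T _ _.
      apply: (path_enters_below _ hr); first by rewrite (anc_of_root T).
      by rewrite -hl; case: (p2) => [|z s] /=;
        rewrite ?anc_refl // rev_cons last_rcons anc_refl.
    rewrite inE mem_rev => /orP[/eqP pr|/mem_belast].
      case: p2 hl {hp2} => [/= uE|z s hl]; first by rewrite uE eqxx in ur.
      by rewrite pr -hl /= mem_last.
    by rewrite inE (negPf (neq_par T ur)).
  rewrite -cat_cons cat_uniq => /and3P[_ /hasPn/(_ _ i2)].
  by rewrite /= i1.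
move=> uw; have [p [h1 h2 h3 h4]] := up_path w.
have hs : size p < #|V| by have := max_card (mem (w :: p));
  rewrite (card_uniqP h3).
exists (Ordinal hs); apply/existsP; exists (in_tuple p).
by rewrite /= h1 h2 eqxx -cons_uniq h3 h4 uw.
Qed.

Lemma component_below u : u \in kids root ->
  [set w | anc u w] \subset component_without e root u.
Proof.
move=> uk; have ur : u != root by move: uk; rewrite inE => /andP[].
apply/subsetP => w; rewrite !inE.
elim/(lvl_ind T): w => [|w wr IH]; first by rewrite (anc_of_root T) (negPf ur).
rewrite (ancE T) wr /= => /orP[/eqP -> //|uw].
apply: connect_trans (IH uw) (connect1 _); rewrite /= wr.
rewrite (ptree_symmetric T) (edge_par T wr) andbT andbT.
by apply/eqP => pr; move: uw; rewrite pr (anc_of_root T) (negPf ur).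
Qed.

Lemma kid_above w : w != root -> exists2 u, u \in kids root & anc u w.
Proof.
elim/(lvl_ind T): w => [|w wr IH _]; first by rewrite eqxx.
case: (eqVneq (par w) root) => [pr|/IH[u uk uw]].
  by exists w; rewrite ?anc_refl // inE wr pr eqxx.
by exists u; rewrite // (ancE T) wr uw orbT.
Qed.

Lemma lf_root_ge_kids : #|kids root| <= lf root.
Proof.
rewrite (lf_kids T) -sum1_card; apply: leq_trans (leq_addl _ _).
by apply: leq_sum => y _; exact: lf_gt0 T _.
Qed.

(** A step from the root to [u] comes closer by one to the nodes below [u] and moves away by one
    from all others. This shows that a median of the leaves is leaf-central. *)
Lemma sum_dist_kid (A : {set V}) u : u \in kids root ->
  \sum_(w in A) dist e u w + 2 * \sum_(w in A) anc u w =
  \sum_(w in A) dist e root w + #|A|.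
Proof.
rewrite inE => /andP[ur /eqP pr]; rewrite -sum1_card big_distrr -!big_split /=.
apply: eq_bigr => w _; rewrite !(dist_sep T).
by have := sep_par T w ur; rewrite pr; case: (anc u w) => /=; lia.
Qed.

End PtreeGraph.

(** * Decomposition of [x * (L - x)] into clipped functions *)

Lemma sum_minn x m :
  \sum_(t < m) 2 * minn x t.+1 = minn x m * (2 * m + 1 - minn x m).
Proof.
elim: m => [|m IH]; first by rewrite big_ord0 minn0.
rewrite big_ord_recr /= IH.
case: (leqP x m) => h; last by have -> : minn x m.+1 = m.+1 by [lia]; nia.
have -> : minn x m.+1 = x by lia.
nia.
Qed.

(** Minus the second differences of [x * (L - x)], which are 2, and for the top index its slope on
    the last step up to [L./2], which is 1 or 2 by the parity of [L]. *)
Definition clip_coef (L t : nat) : nat := if t.+1 == L./2 then (odd L).+1 else 2.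

Lemma clip_decomposition L x : 1 < L ->
  \sum_(t < L./2) clip_coef L t * minn x t.+1 =
  minn x L./2 * (L - minn x L./2).
Proof.
move=> L1; have LE := odd_double_half L; rewrite -addnn in LE;
  rewrite /clip_coef.
case E: L./2 => [|m]; first by rewrite E in LE; lia.
rewrite E in LE; rewrite big_ord_recr /= eqxx.
rewrite (eq_bigr (fun t : 'I_m => 2 * minn x t.+1)) => [|t _]; last first.
  by rewrite ifF //; have := ltn_ord t; lia.
rewrite sum_minn; case: (leqP x m) => h.
  have -> : minn x m.+1 = x by lia.
  nia.
have -> : minn x m.+1 = m.+1 by lia.
nia.
Qed.

(** The parabola is largest at its middle. This serves the comparison tree, about whose root no
    leaf-centrality is known. *)
Lemma clip_upper L x : x <= L -> x * (L - x) <= minn x L./2 * (L - minn x L./2).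
Proof.
move=> xL; have LE := odd_double_half L; rewrite -addnn in LE.
case: (leqP x L./2) => // h.
have [y xE] : exists y, x = L./2 + y by exists (x - L./2); lia.
have [z zE] : exists z, L = x + z by exists (L - x); lia.
rewrite zE in LE *; rewrite addKn; nia.
Qed.

Section Clip.

Variables (V : finType) (e : rel V) (root : V) (par : V -> V) (lvl : V -> nat).
Hypothesis T : ptree e root par lvl.

Local Notation lf := (lf root par lvl).

Definition clipped (t : nat) : nat := \sum_(u | u != root) minn (lf u) t.

Lemma sum_clipped (c : nat -> nat) m :
  \sum_(t < m) c t * clipped t.+1 =
  \sum_(u | u != root) \sum_(t < m) c t * minn (lf u) t.+1.
Proof. by rewrite exchange_big; apply: eq_bigr => t _; rewrite big_distrr. Qed.

Lemma clipped_core (B : {set V}) t : root \in B ->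
  t * #|B|.-1 + below_sum root par lvl B =
  \sum_(u | u != root) (if u \in B then t else lf u).
Proof.
move=> rB; rewrite [RHS](bigID (mem B)) /=; congr (_ + _).
  rewrite (eq_bigr (fun=> t)) => [|u /andP[_ ->] //].
  rewrite sum_nat_cond_const mulnC; congr (_ * _).
  rewrite (cardsD1 root) rB /=; apply: eq_card => u; rewrite !inE.
  by [].
apply: eq_big => [u|u uB]; last by rewrite (negPf uB).
case: (boolP (u \in B)) => uB; first by rewrite andbF.
by rewrite andbT; case: eqP => // ur; rewrite ur rB in uB.
Qed.

Lemma clipped_le (B : {set V}) t : root \in B ->
  clipped t <= t * #|B|.-1 + below_sum root par lvl B.
Proof.
move=> rB; rewrite clipped_core //; apply: leq_sum => u _.
by case: ifP => _; lia.
Qed.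

(** A node with exactly [t] leaves may be put on either side of the cut; the argument on partially
    filled subtrees exploits this freedom. *)
Lemma clipped_eq (B : {set V}) t : root \in B ->
  (forall u, u != root -> t < lf u -> u \in B) ->
  (forall u, u != root -> u \in B -> t <= lf u) ->
  clipped t = t * #|B|.-1 + below_sum root par lvl B.
Proof.
move=> rB h1 h2; rewrite clipped_core //; apply: eq_bigr => u ur.
case: ifP => uB; first by have := h2 u ur uB; lia.
by case: (leqP (lf u) t) => [/minn_idPl //|/(h1 u ur)]; rewrite uB.
Qed.

End Clip.

(** For [L >= 3] this is [(L - 2) / b.-1] rounded up, the number of internal nodes of the heap with
    [L] leaves. *)
Definition internal_count (b L : nat) : nat := ((L - 3) %/ b.-1).+1.

Lemma internal_countP b L : 2 <= b -> b < L -> let i := internal_count b L in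
  i.-1 * b.-1 + 3 <= L <= i * b.-1 + 2.
Proof.
move=> b2 bL; rewrite /internal_count /=.
have := divn_eq (L - 3) b.-1; have := @ltn_pmod (L - 3) b.-1.
by rewrite mulSn; lia.
Qed.

(** * Comparison of an optimal tree with the heap *)

Section Comparison.

Variables (V : finType) (e : rel V) (root : V) (par : V -> V) (lvl : V -> nat).
Hypothesis T : ptree e root par lvl.
Variable b : nat.
Hypothesis b2 : 2 <= b.
Hypothesis Har : arity_le root par b.
Hypothesis root2 : 1 < #|kids root par root|.

Local Notation lf := (lf root par lvl).
Local Notation L := (lf root).

Hypothesis bL : b < L.
Hypothesis leaf_central : forall u, u != root -> 2 * lf u <= L.
Hypothesis minimal : forall (V' : finType) (e' : rel V'),
  is_tree e' -> max_degree e' <= b.+1 -> #|leaves e'| = L ->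
  sigma_LL e <= sigma_LL e'.

Local Notation i := (internal_count b L).

Section Frugal.

Variables (V' : finType) (e' : rel V') (r' : V') (par' : V' -> V') (lvl' : V' -> nat).
Hypothesis G : frugal b i L e' r' par' lvl'.

Lemma frugal_max_degree : max_degree e' <= b.+1.
Proof.
apply/bigmax_leqP => x _; rewrite (degree_kids (frugal_ptree G)).
by have := frugal_arity G x; case: eqP => /=; lia.
Qed.

Lemma frugal_sigma_le : sigma_LL e <= sigma_LL e'.
Proof.
apply: minimal;
  [exact: ptree_is_tree (frugal_ptree G)|exact: frugal_max_degree|].
rewrite (leaves_childless (frugal_ptree G) (frugal_root G)).
by rewrite -(lf_root (frugal_ptree G)) (frugal_leaves G).
Qed.

(** The slack identity is used in both trees with the same [k], the same number of leaves and
    equally large cores, so the two values of [b.-1 * below_sum] differ by the difference of the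
    slacks. *)
Lemma frugal_below_sum (B : {set V}) : core root par B -> #|B| <= i ->
  exists (B' : {set V'}) k, [/\ r' \in B', #|B'| = #|B|,
    below_sum r' par' lvl' B' <= below_sum root par lvl B
    & below_sum root par lvl B <= below_sum r' par' lvl' B' ->
      \sum_x slack root par lvl b B k x <= b - 2].
Proof.
move=> cB Bi; have B0 : 0 < #|B| by apply/card_gt0P; exists root; case: cB.
have [|B' [k [cB' cardB' hs]]] := @frugal_slack _ _ _ _ _ _ _ _ G #|B|.-1;
  first lia.
have {}cardB' : #|B'| = #|B| by lia.
have := slack_identity (frugal_ptree G) b2 cB' (frugal_arity G) k.
have := slack_identity T b2 cB Har k.
rewrite (frugal_leaves G) cardB' => h1 h2.
exists B', k; split; [by case: cB'|by []| |]; last by nia.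
(* The heap's slack is below [b.-1], so a multiple of [b.-1] cannot exceed the other by less than
   that: this is where integrality enters. *)
have : b.-1 * below_sum r' par' lvl' B' < b.-1 * (below_sum root par lvl B).+1.
  by rewrite mulnS; lia.
by rewrite ltn_mul2l => /andP[_]; lia.
Qed.

Lemma below_sum_ge (B : {set V}) : core root par B -> L <= below_sum root par lvl B.
Proof.
move=> cB; rewrite (below_sum_childless root par lvl B).
rewrite (lf_root T) -sum1dep_card; apply: leq_sum => x cx.
have xB := childless_notin_core cB cx.
by rewrite (bdepth_par T B (notin_core_neq_root cB xB)) xB.
Qed.

(** With all [i] internal nodes cut off, only single leaves of depth 1 remain. *)
Lemma frugal_all : exists B' : {set V'}, [/\ r' \in B', #|B'| = i
  & below_sum r' par' lvl' B' = L].
Proof.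
have i0 : 0 < i by [].
have [|B' [k [cB' cardB' _]]] := @frugal_slack _ _ _ _ _ _ _ _ G i.-1;
  first lia.
exists B'; split; [by case: cB'|lia|].
have hC : [set x | childless r' par' x] = ~: B'.
  apply/eqP; rewrite eqEcard; apply/andP; split.
    by apply/subsetP => x; rewrite !inE => /(childless_notin_core cB').
  rewrite -(lf_root (frugal_ptree G)) (frugal_leaves G) cardsCs setCK.
  by rewrite (frugal_card G) cardB'; lia.
rewrite /below_sum -[RHS](frugal_leaves G) (lf_root (frugal_ptree G)) -sum1dep_card.
have hE x : (x \notin B') = childless r' par' x.
  by have /setP/(_ x) := hC; rewrite !inE.
by apply: eq_big => // x; rewrite hE => /(lf_childless (frugal_ptree G)).
Qed.

Definition heavy (t : nat) : {set V} := [set u | (u == root) || (t < lf u)].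

Lemma core_heavy t : 0 < t -> core root par (heavy t).
Proof.
move=> t0; split; first by rewrite inE eqxx.
- move=> x; rewrite !inE => /orP[/eqP ->|hx xr]; first by rewrite eqxx.
  apply/orP; right; apply: leq_trans hx _; apply: (lf_anc T).
  by rewrite (ancE T) xr anc_refl orbT.
move=> x; rewrite inE => /orP[/eqP ->|hx].
  by rewrite /childless -cards_eq0; lia.
by apply/negP => /(lf_childless T); lia.
Qed.

(** The cut at the nodes with more than [t] leaves is exact for the given tree, while any cut of the
    heap gives an upper bound for its sum. *)
Lemma clipped_frugal_le t : 0 < t ->
  clipped r' par' lvl' t <= clipped root par lvl t.
Proof.
move=> t0; have ch := core_heavy t0.
have rh : root \in heavy t by case: ch.
rewrite (@clipped_eq _ root par lvl (heavy t)) //; last first.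
- by move=> u ur; rewrite inE (negPf ur) => /ltnW.
- by move=> u ur; rewrite inE (negPf ur).
case: (leqP #|heavy t| i) => hi.
  have [B' [k [rB' cB' hle _]]] := frugal_below_sum ch hi.
  by apply: leq_trans (clipped_le _ _ _ rB') _; rewrite cB' leq_add2l.
(* When there are more than [i] heavy nodes, the heap is cut at all its internal nodes instead. *)
have [B' [rB' cB' hE]] := frugal_all.
apply: leq_trans (clipped_le _ _ _ rB') _; rewrite cB' hE.
apply: leq_add; last exact: below_sum_ge.
by rewrite leq_mul2l; apply/orP; right; lia.
Qed.

(** Optimality bounds a positive combination of the clipped sums by the same combination for the
    heap, while each summand satisfies the opposite inequality. Hence all agree. *)
Lemma clipped_frugal_eq t : 0 < t <= L./2 ->
  clipped root par lvl t = clipped r' par' lvl' t.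
Proof.
move=> /andP[t0 th]; have L1 : 1 < L by lia.
have hT : sigma_LL e = \sum_(s < L./2) clip_coef L s * clipped root par lvl s.+1.
  rewrite (sigma_LL_lf T root2) (sum_clipped root par lvl (clip_coef L)).
  apply: eq_bigr => u ur; rewrite clip_decomposition //.
  have -> : minn (lf u) L./2 = lf u; last by [].
  by have := leaf_central ur; have := odd_double_half L; rewrite -addnn; lia.
have hG : sigma_LL e' <= \sum_(s < L./2) clip_coef L s * clipped r' par' lvl' s.+1.
  rewrite (sigma_LL_lf (frugal_ptree G) (frugal_root G)) (frugal_leaves G).
  rewrite (sum_clipped r' par' lvl' (clip_coef L)).
  apply: leq_sum => u ur; rewrite clip_decomposition // clip_upper //.
  by rewrite -(frugal_leaves G) (lf_le_root (frugal_ptree G)).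
have := leq_trans frugal_sigma_le hG; rewrite hT.
have ht : t.-1 < L./2 by lia.
rewrite (bigD1 (Ordinal ht)) //= [X in _ <= X](bigD1 (Ordinal ht)) //= prednK //.
set S1 := \sum_(s < _ | _) _; set S2 := \sum_(s < _ | _) _ => hle.
have hS : S2 <= S1.
  by apply: leq_sum => s _; rewrite leq_mul2l clipped_frugal_le ?orbT.
apply/eqP; rewrite eqn_leq clipped_frugal_le // andbT.
have : clip_coef L t.-1 * clipped root par lvl t <= clip_coef L t.-1 * clipped r' par' lvl' t.
  by lia.
rewrite leq_mul2l => /orP[|//]; rewrite /clip_coef.
by case: ifP.
Qed.

End Frugal.

Lemma exists_frugal : exists V' e' r' par' lvl', @frugal b i L V' e' r' par' lvl'.
Proof.
have /andP[h1 h2] := internal_countP b2 bL.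
by do 5 eexists; exact: heap_frugal.
Qed.

(** For [t = 1] every node but the root contributes exactly 1 to the clipped sum. *)
Lemma optimal_card : #|V| = L + i.
Proof.
have [V' [e' [r' [par' [lvl' G]]]]] := exists_frugal.
have clip1 (W : finType) (f : rel W) r p l : ptree f r p l -> (clipped r p l 1).+1 = #|W|.
  move=> TW; rewrite /clipped (eq_bigr (fun=> 1)) => [|u _]; last first.
    by have := lf_gt0 TW u; lia.
  rewrite sum1_card (cardC1 r) prednK //.
  by apply/card_gt0P; exists r.
have := clipped_frugal_eq G (t := 1).
rewrite -(frugal_card G) -(clip1 _ _ _ _ _ T) -(clip1 _ _ _ _ _ (frugal_ptree G)).
by move=> -> //; have := odd_double_half L; rewrite -addnn; lia.
Qed.

(** For an admissible cut the clipped sum is exact, and for the heap it is bounded by a cut of the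
    same size. Equal clipped sums thus force the equality case of the comparison of [below_sum]. *)
Lemma optimal_slack (B : {set V}) t : 0 < t <= L./2 -> core root par B ->
  (forall u, u != root -> t < lf u -> u \in B) ->
  (forall u, u != root -> u \in B -> t <= lf u) ->
  exists k, \sum_x slack root par lvl b B k x <= b - 2.
Proof.
move=> ht cB h1 h2; have [V' [e' [r' [par' [lvl' G]]]]] := exists_frugal.
have Bi : #|B| <= i.
  rewrite -(leq_add2l L) -optimal_card -(cardC (mem B)) addnC leq_add2l.
  rewrite (lf_root T); apply: subset_leq_card; apply/subsetP => x.
  by rewrite !inE => /(childless_notin_core cB).
have [B' [k [rB' cB' _ hk]]] := frugal_below_sum G cB Bi.
exists k; apply: hk; have := clipped_frugal_eq G ht.
have rB : root \in B by case: cB.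
rewrite (@clipped_eq _ root par lvl B) // => hE.
by have := clipped_le par' lvl' t rB'; rewrite -hE cB' leq_add2l.
Qed.

End Comparison.

(** * The layer structure of an optimal tree *)

Record layered (V : finType) (root : V) (par : V -> V) (lvl : V -> nat)
    (b K : nat) : Prop := Layered {
  layered_gt0 : 0 < K;
  layered_root : #|kids root par root| = b.+1;
  layered_full : forall x, 0 < lvl x < K -> #|kids root par x| = b;
  layered_last : forall x, K < lvl x -> childless root par x;
  layered_arity : forall x, lvl x = K -> ~~ childless root par x ->
    2 <= #|kids root par x| <= b }.

Section Layers.

Variables (V : finType) (e : rel V) (root : V) (par : V -> V) (lvl : V -> nat).
Hypothesis T : ptree e root par lvl.
Variable b : nat.
Hypothesis b2 : 2 <= b.

Local Notation anc := (anc par lvl).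
Local Notation kids := (kids root par).
Local Notation lf := (lf root par lvl).
Local Notation childless := (childless root par).

Section LayerCounts.

Variable K : nat.
Hypothesis Lay : layered root par lvl b K.

Lemma kids_layer m x : 0 < lvl x -> lvl x + m.+1 = K -> #|kids x| = b.
Proof. by move=> x0 hK; apply: (layered_full Lay); lia. Qed.

Lemma lf_layer_kids m x : 0 < lvl x -> lvl x + m.+1 = K ->
  lf x = \sum_(y in kids x) lf y.
Proof.
move=> x0 hK; apply: (lf_kids_internal T).
by rewrite /childless -cards_eq0 (kids_layer x0 hK); lia.
Qed.

Lemma lf_layer_last x : lvl x = K -> lf x = maxn 1 #|kids x|.
Proof.
move=> xK; case: (boolP (childless x)) => cx.
  by rewrite (lf_childless T cx); move/eqP: cx => ->; rewrite cards0.
rewrite (lf_kids_internal T cx) (eq_bigr (fun=> 1)) => [|y yx]; last first.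
  apply: (lf_childless T); apply: (layered_last Lay).
  by rewrite (lvl_kid T yx); lia.
by rewrite sum1_card; have := layered_arity Lay xK cx; lia.
Qed.

Lemma card_kids_last_le x : lvl x = K -> #|kids x| <= b.
Proof.
move=> xK;
  case: (boolP (childless x)) => [/eqP ->|/(layered_arity Lay xK)/andP[]//].
by rewrite cards0.
Qed.

(** The extremes belong to a subtree with no node, respectively with every place filled, on level
    [K.+1]. *)
Lemma lf_bounds m x : 0 < lvl x -> lvl x + m = K -> b ^ m <= lf x <= b ^ m.+1.
Proof.
elim: m x => [|m IH] x x0 xK.
  have xK' : lvl x = K by lia.
  have := card_kids_last_le xK'; rewrite (lf_layer_last xK') expn0 expn1; lia.
rewrite (lf_layer_kids x0 xK) !(expnS b m.+1) (expnS b m).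
have hb y : y \in kids x -> b ^ m <= lf y <= b ^ m.+1.
  by move=> yx; apply: IH; rewrite (lvl_kid T yx); lia.
rewrite -{1 3}(kids_layer x0 xK) -!sum_nat_const -expnS.
by apply/andP; split; apply: leq_sum => y /hb/andP[].
Qed.

Lemma lf_full m x : 0 < lvl x -> lvl x + m = K ->
  (forall y, anc x y -> lvl y = K -> #|kids y| = b) -> lf x = b ^ m.+1.
Proof.
elim: m x => [|m IH] x x0 xK h.
  have xK' : lvl x = K by lia.
  by rewrite (lf_layer_last xK') h ?anc_refl // expn1; lia.
rewrite (lf_layer_kids x0 xK) (eq_bigr (fun=> b ^ m.+1)) => [|y yx].
  by rewrite sum_nat_const (kids_layer x0 xK) -expnS.
apply: IH; rewrite ?(lvl_kid T yx); [lia..|].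
by move=> z yz; apply: h; apply: (anc_trans T) yz; apply: (anc_kid T).
Qed.

Lemma lf_empty m x : 0 < lvl x -> lvl x + m = K ->
  (forall y, anc x y -> lvl y = K -> childless y) -> lf x = b ^ m.
Proof.
elim: m x => [|m IH] x x0 xK h.
  by rewrite (lf_childless T) // h ?anc_refl //; lia.
rewrite (lf_layer_kids x0 xK) (eq_bigr (fun=> b ^ m)) => [|y yx].
  by rewrite sum_nat_const (kids_layer x0 xK) -expnS.
apply: IH; rewrite ?(lvl_kid T yx); [lia..|].
by move=> z yz; apply: h; apply: (anc_trans T) yz; apply: (anc_kid T).
Qed.

Lemma lf_full_kid m x y : 0 < lvl x -> lvl x + m.+1 = K -> lf x = b ^ m.+2 ->
  y \in kids x -> lf y = b ^ m.+1.
Proof.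
move=> x0 xK xf yx.
have hb z : z \in kids x -> lf z <= b ^ m.+1.
  move=> zx; suff /andP[] : b ^ m <= lf z <= b ^ m.+1 by [].
  by apply: lf_bounds; rewrite (lvl_kid T zx); lia.
apply/eqP; rewrite eqn_leq hb //= leqNgt; apply/negP => hy.
have : lf x < b ^ m.+2; last by rewrite xf ltnn.
rewrite (lf_layer_kids x0 xK) expnS -{1}(kids_layer x0 xK) -sum_nat_const.
rewrite (bigD1 y) //= [X in _ < X](bigD1 y) //= -addSn; apply: leq_add => //.
by apply: leq_sum => z /andP[/hb].
Qed.

Lemma lf_empty_kid m x y : 0 < lvl x -> lvl x + m.+1 = K -> lf x = b ^ m.+1 ->
  y \in kids x -> lf y = b ^ m.
Proof.
move=> x0 xK xf yx.
have hb z : z \in kids x -> b ^ m <= lf z.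
  move=> zx; suff /andP[] : b ^ m <= lf z <= b ^ m.+1 by [].
  by apply: lf_bounds; rewrite (lvl_kid T zx); lia.
apply/eqP; rewrite eqn_leq hb // andbT leqNgt; apply/negP => hy.
have : b ^ m.+1 < lf x; last by rewrite xf ltnn.
rewrite (lf_layer_kids x0 xK) expnS -{1}(kids_layer x0 xK) -sum_nat_const.
rewrite (bigD1 y) //= [X in _ < X](bigD1 y) //= -addSn; apply: leq_add => //.
by apply: leq_sum => z /andP[/hb].
Qed.

End LayerCounts.

Hypothesis Har : arity_le root par b.
Local Notation L := (lf root).
Hypothesis bL : b < L.
Hypothesis leaf_central : forall u, u != root -> 2 * lf u <= L.
Hypothesis opt_slack : forall (B : {set V}) t, 0 < t <= L./2 -> core root par B ->
  (forall u, u != root -> t < lf u -> u \in B) ->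
  (forall u, u != root -> u \in B -> t <= lf u) ->
  exists k, \sum_x slack root par lvl b B k x <= b - 2.

Lemma root_internal : ~~ childless root.
Proof. by apply/negP => /(lf_childless T); lia. Qed.

Lemma lf_le_half u : u != root -> lf u <= L./2.
Proof.
by move/leaf_central; have := odd_double_half L; rewrite -addnn; lia.
Qed.

(** For [t = L./2] the root alone is an admissible cut. Relative depths are then levels, and the
    bounds on the slack describe the layers. *)
Lemma optimal_layered : exists K, layered root par lvl b K.
Proof.
have cB : core root par [set root].
  split=> [|x|x]; rewrite ?inE //; first by move=> /eqP ->; rewrite eqxx.
  by move/eqP => ->; exact: root_internal.
have [|u ur|u ur|k hk] := opt_slack _ cB (t := L./2).
- by have := odd_double_half L; rewrite -addnn; lia.
- by rewrite ltnNge lf_le_half.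
- by rewrite inE (negPf ur).
have dE x : bdepth par lvl [set root] x = lvl x.
  rewrite -(sum_anc_lvl T); apply: eq_bigl => u.
  by rewrite inE.
have leafR x : childless x -> k <= lvl x <= k.+1.
  by move=> /(slack_leaf_range T b2 cB hk); rewrite dE.
have intR x : x != root -> ~~ childless x ->
    [/\ lvl x <= k, lvl x < k -> #|kids x| = b & 2 <= #|kids x|].
  move=> xr cx; rewrite -(dE x); apply: (slack_internal T b2 cB Har hk) => //.
  by rewrite inE.
(* For [k = 0] the tree is a star, which counts as layered with [K = 1]. *)
case: (posnP k) => k0.
  have allc x : x != root -> childless x.
    move=> xr; apply/negPn/negP => cx; have [h _ _] := intR x xr cx.
    by move: xr; rewrite -(lvl_gt0 T); lia.
  exists 1; split=> // [|x|x|x x1].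
  - have := Har root; rewrite eqxx => h1.
    have : L = #|kids root|; last by lia.
    rewrite (lf_kids_internal T root_internal) -sum1_card.
    apply: eq_bigr => y; rewrite inE => /andP[yr _].
    by apply: (lf_childless T); apply: allc.
  - by lia.
  - by move=> x1; apply: allc; rewrite -(lvl_gt0 T); lia.
  - by rewrite allc // -(lvl_gt0 T) x1.
exists k; split=> // [|x /andP[x0 xk]|x xk|x xk cx].
- by rewrite (slack_core b2 Har hk) ?inE ?eqxx // addn1.
- have cx : ~~ childless x by apply/negP => /leafR; lia.
  have xr : x != root by rewrite -(lvl_gt0 T).
  by have [_ -> //] := intR x xr cx.
- apply/negPn/negP => cx.
  have xr : x != root by rewrite -(lvl_gt0 T); lia.
  by have [h _ _] := intR x xr cx; lia.
have xr : x != root by rewrite -(lvl_gt0 T); lia.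
have [_ _ ->] := intR x xr cx.
by have := Har x; rewrite (negPf xr) addn0.
Qed.

(* If [u] and [w] were both partially filled, cut off everything heavier than
   [u], and [u] itself: then the leaves below [w] on the last level are at
   least two steps deeper than the unfilled places below [u]. *)
Lemma optimal_one_mixed K m u w : layered root par lvl b K ->
  0 < lvl u -> lvl u + m = K -> lvl w = lvl u -> u != w -> lf w <= lf u ->
  b ^ m < lf w -> lf u < b ^ m.+1 -> False.
Proof.
move=> Lay u0 uK wu uw hwu mw mu.
have ur : u != root by rewrite -(lvl_gt0 T).
have wr : w != root by rewrite -(lvl_gt0 T) wu.
(* The threshold is [t = lf u]; as [lf w <= lf u], the node [w] may stay outside even in case of a
   tie. *)
pose B := [set x | (x == root) || (lf u <= lf x) && (x != w)].
have bm0 : 0 < b ^ m by rewrite expn_gt0; lia.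
have below x : lvl u < lvl x -> lf x <= b ^ m.
  move=> ux; case: (leqP (lvl x) K) => xK.
    have /andP[_] : b ^ (K - lvl x) <= lf x <= b ^ (K - lvl x).+1.
      by apply: (lf_bounds Lay); lia.
    by move/leq_trans; apply; rewrite leq_exp2l; lia.
  by rewrite (lf_childless T) // (layered_last Lay).
have aboveB x : x \notin B -> x != w -> lvl u <= lvl x.
  rewrite inE => + xw; rewrite xw andbT negb_or => /andP[xr hx].
  rewrite leqNgt; apply/negP => xu; move: hx; rewrite -ltnNge.
  have /andP[+ _] : b ^ (K - lvl x) <= lf x <= b ^ (K - lvl x).+1.
    by apply: (lf_bounds Lay); rewrite ?(lvl_gt0 T) //; lia.
  have : b ^ m.+1 <= b ^ (K - lvl x) by rewrite leq_exp2l; lia.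
  lia.
have belowB x : lvl u < lvl x -> x \notin B.
  move=> ux; rewrite inE negb_or -(lvl_gt0 T).
  by have := below x ux; lia.
have cB : core root par B.
  split; first by rewrite inE eqxx.
    move=> x xB xr; apply/negPn/negP => pB.
    have hl := lvl_par T xr.
    case: (eqVneq (par x) w) => [pw|/(aboveB _ pB) h].
      by move: xB; apply/negP; apply: belowB; rewrite hl pw; lia.
    by move: xB; apply/negP; apply: belowB; rewrite hl; lia.
  move=> x; rewrite inE => /orP[/eqP ->|/andP[hx _]];
    first exact: root_internal.
  by apply/negP => /(lf_childless T); lia.
have [|||k hk] := opt_slack _ cB (t := lf u).
- by rewrite (lf_gt0 T) /= lf_le_half.
- by move=> x xr hx; rewrite inE (ltnW hx) /=; apply/orP; right;
  apply: contraTneq hx => ->; lia.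
- by move=> x xr; rewrite inE (negPf xr) => /andP[].
have uB : u \in B by rewrite inE leqnn uw orbT.
have wB : w \notin B by rewrite inE (negPf wr) eqxx andbF.
have dw x : anc w x -> bdepth par lvl B x = (lvl x - lvl w).+1.
  elim/(lvl_ind T): x => [|x xr IH];
    first by rewrite (anc_of_root T) (negPf wr).
  case: (eqVneq w x) => [<- _|wx hx].
    have pB : par w \in B.
      apply/negPn/negP => pB; have := lvl_par T wr.
      case: (eqVneq (par w) w) => [->|/(aboveB _ pB)]; lia.
    by rewrite (bdepth_par T B wr) wB (bdepth_in T cB pB) subnn.
  have hp := anc_par_r T hx wx.
  rewrite (bdepth_par T B xr) IH // (lvl_par T xr) belowB.
    by rewrite add1n subSn // (anc_lvl hp).
  by rewrite (lvl_par T xr) -wu ltnS (anc_lvl hp).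
have du x : anc u x -> bdepth par lvl B x = lvl x - lvl u.
  elim/(lvl_ind T): x => [|x xr IH];
    first by rewrite (anc_of_root T) (negPf ur).
  case: (eqVneq u x) => [<- _|ux hx];
    first by rewrite (bdepth_in T cB uB) subnn.
  have hp := anc_par_r T hx ux.
  rewrite (bdepth_par T B xr) IH // (lvl_par T xr) belowB.
    by rewrite add1n subSn // (anc_lvl hp).
  by rewrite (lvl_par T xr) ltnS (anc_lvl hp).
(* Some node on level [K] below [w] has children; it has relative depth [m.+1], which therefore is
   at most [k]. *)
have km : m < k.
  have [y wy [yK cy]] : exists2 y, anc w y & lvl y = K /\ ~~ childless y.
    case: (boolP [exists y, [&& anc w y, lvl y == K & ~~ childless y]]).
      by case/existsP => y /and3P[h1 /eqP h2 h3]; exists y.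
    rewrite negb_exists => /forallP h.
    have := lf_empty Lay (m := m) (x := w); rewrite wu => hE.
    suff hE' : lf w = b ^ m by rewrite hE' ltnn in mw.
    apply: hE => // y wy yK; have := h y; rewrite wy yK eqxx /=.
    by rewrite negbK.
  have yB : y \notin B.
    case: (eqVneq y w) => [->//|yw]; apply: belowB; rewrite -wu.
    move: (anc_lvl wy); rewrite leq_eqVlt => /orP[/eqP h|//].
    by move: wy; rewrite (anc_same_lvl _ h) eq_sym (negPf yw).
  have [+ _ _] := slack_internal T b2 cB Har hk yB cy.
  by rewrite (dw y wy) yK; lia.
(* Nodes on level [K] below [u] have relative depth [m < k], too small for a leaf or for a missing
   child. *)
have fullu y : anc u y -> lvl y = K -> #|kids y| = b.
  move=> uy yK; case: (eqVneq u y) => [<-|uy'].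
    by rewrite (slack_core b2 Har hk uB) ?(negPf ur) ?addn0 //; lia.
  have yB : y \notin B.
    apply: belowB; move: (anc_lvl uy); rewrite leq_eqVlt => /orP[/eqP h|//].
    by move: uy; rewrite (anc_same_lvl _ h) (negPf uy').
  case: (boolP (childless y)) => cy.
    by have := slack_leaf_range T b2 cB hk cy; rewrite (du y uy) yK; lia.
  have [_ -> //] := slack_internal T b2 cB Har hk yB cy.
  by rewrite (du y uy) yK; lia.
by move: mu; rewrite (lf_full Lay u0 uK fullu) ltnn.
Qed.

End Layers.

(** * The left-to-right order of the nodes *)

Section Ordering.

Variables (V : finType) (e : rel V) (root : V) (par : V -> V) (lvl : V -> nat).
Hypothesis T : ptree e root par lvl.

Local Notation kids := (kids root par).
Local Notation lf := (lf root par lvl).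
Local Notation childless := (childless root par).

(** The order among siblings; [enum_rank] breaks ties to make it total. *)
Definition before (x y : V) : bool :=
  (lf y < lf x) || (lf x == lf y) && (enum_rank x < enum_rank y).

(* Nodes of one level are compared through their highest distinct ancestors,
   the one with more leaves coming first. *)
Fixpoint lex_before (n : nat) (x y : V) : bool :=
  if par x == par y then before x y
  else if n is n'.+1 then lex_before n' (par x) (par y) else false.

Definition ltr (x y : V) : bool := lex_before (lvl x) x y.

Lemma ltrE x y : x != root ->
  ltr x y = if par x == par y then before x y else ltr (par x) (par y).
Proof. by move=> xr; rewrite /ltr (lvl_par T xr). Qed.

Lemma before_irr : irreflexive before.
Proof. by move=> x; rewrite /before !ltnn andbF. Qed.

Lemma before_trans : transitive before.
Proof. by move=> y x z; rewrite /before; lia. Qed.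

Lemma ltr_irr : irreflexive ltr.
Proof. by move=> x; rewrite /ltr; case: (lvl x) => [|n] /=;
  rewrite eqxx before_irr. Qed.

Lemma same_lvl_root x y : lvl x = lvl y -> (x == root) = (y == root).
Proof. by move=> h; rewrite -!(lvl_eq0 T) h. Qed.

Lemma same_lvl_par x y : x != root -> lvl x = lvl y -> lvl (par x) = lvl (par y).
Proof.
move=> xr h; have yr : y != root by rewrite -(same_lvl_root h).
by move: (lvl_par T xr) (lvl_par T yr); lia.
Qed.

Lemma ltr_trans x y z : lvl x = lvl y -> lvl y = lvl z ->
  ltr x y -> ltr y z -> ltr x z.
Proof.
elim/(lvl_ind T): x y z => [|x xr IH] y z xy yz.
  by have := same_lvl_root xy; rewrite eqxx => /esym/eqP ->; rewrite ltr_irr.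
have yr : y != root by rewrite -(same_lvl_root xy).
have pxy := same_lvl_par xr xy; have pyz := same_lvl_par yr yz.
rewrite (ltrE y xr) (ltrE z xr) (ltrE z yr).
case: (eqVneq (par x) (par y)) => [->|nxy].
  by case: ifP => // _; apply: before_trans.
case: (eqVneq (par y) (par z)) => [<-|nyz]; first by rewrite (negPf nxy).
(* If [x] and [z] have the same parent, that parent would precede itself by transitivity one level
   up. *)
case: (eqVneq (par x) (par z)) => [<-|nxz] h1 h2; last exact: IH pxy pyz h1 h2.
by have := IH _ _ pxy (esym pxy) h1 h2; rewrite ltr_irr.
Qed.

Lemma ltr_total x y : lvl x = lvl y -> x != y -> ltr x y || ltr y x.
Proof.
elim/(lvl_ind T): x y => [|x xr IH] y xy nxy.
  by have := same_lvl_root xy; rewrite eqxx eq_sym (negPf nxy).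
have yr : y != root by rewrite -(same_lvl_root xy).
rewrite (ltrE y xr) (ltrE x yr) (eq_sym (par y)).
case: eqP => [_|/eqP]; last exact: IH (same_lvl_par xr xy).
rewrite /before; have : enum_rank x != enum_rank y :> nat.
  by rewrite val_eqE (inj_eq enum_rank_inj).
lia.
Qed.

Lemma ltr_kids x y x' y' : lvl x = lvl y -> ltr x y ->
  x' \in kids x -> y' \in kids y -> ltr x' y'.
Proof.
rewrite !inE => _ xy /andP[x'r /eqP px] /andP[_ /eqP py].
rewrite ltrE // px py; case: eqP => // xE.
by rewrite xE ltr_irr in xy.
Qed.

Variables b K : nat.
Hypothesis b2 : 2 <= b.
Hypothesis Lay : layered root par lvl b K.
Hypothesis one_mixed : forall m u w, 0 < lvl u -> lvl u + m = K ->
  lvl w = lvl u -> u != w -> lf w <= lf u -> b ^ m < lf w -> lf u < b ^ m.+1 ->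
  False.

(* Of two different parents on a level, the first has all places below it on
   level [K.+1] filled, or the second has all of them empty. *)
Lemma ltr_lf x y : lvl x = lvl y -> 0 < lvl x <= K -> ltr x y -> lf y <= lf x.
Proof.
elim/(lvl_ind T): x y => [|x xr IH] y xy; first by rewrite (lvl_root T).
have yr : y != root by rewrite -(same_lvl_root xy).
move=> xK; rewrite (ltrE y xr); case: (eqVneq (par x) (par y)) => [_|nxy].
  by rewrite /before; lia.
have pxy := same_lvl_par xr xy; move=> hlt.
have hx := lvl_par T xr; have hy := lvl_par T yr.
case: (posnP (lvl (par x))) => p0.
  move: (p0); rewrite pxy => /eqP; rewrite (lvl_eq0 T) => /eqP py.
  by move/eqP: p0; rewrite (lvl_eq0 T) => /eqP px; rewrite px py eqxx in nxy.
have [m xm] : exists m, lvl (par x) + m.+1 = K by exists (K - (lvl (par x)).+1); lia.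
have ym : lvl (par y) + m.+1 = K by rewrite -pxy.
have p0' : 0 < lvl (par y) by rewrite -pxy.
have xk : x \in kids (par x) by rewrite inE xr eqxx.
have yk : y \in kids (par y) by rewrite inE yr eqxx.
have /andP[x1 x2] : b ^ m <= lf x <= b ^ m.+1 by apply: (lf_bounds T b2 Lay);
  lia.
have /andP[y1 y2] : b ^ m <= lf y <= b ^ m.+1 by apply: (lf_bounds T b2 Lay);
  lia.
have /andP[px1 px2] := lf_bounds T b2 Lay p0 xm.
have /andP[py1 py2] := lf_bounds T b2 Lay p0' ym.
case: (eqVneq (lf (par x)) (b ^ m.+2)) => [xf|nxf].
  by rewrite (lf_full_kid T b2 Lay p0 xm xf xk).
case: (eqVneq (lf (par y)) (b ^ m.+1)) => [yf|nyf].
  by rewrite (lf_empty_kid T b2 Lay p0' ym yf yk).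
have pK : 0 < lvl (par x) <= K by lia.
by case: (one_mixed p0 xm (esym pxy) nxy (IH _ pxy pK hlt)); lia.
Qed.

End Ordering.

(** The root arity [R] is a parameter because subtrees have [R = b]. It is prescribed only for
    [K > 0]; for [K = 0] the root itself is on the last internal level and may be partially
    filled. *)
Record sorted_layers (V : finType) (root : V) (par : V -> V) (lvl : V -> nat)
    (lt : rel V) (R b K : nat) : Prop := SortedLayers {
  sorted_irr : irreflexive lt;
  sorted_trans : forall x y z, lvl x = lvl y -> lvl y = lvl z ->
    lt x y -> lt y z -> lt x z;
  sorted_total : forall x y, lvl x = lvl y -> x != y -> lt x y || lt y x;
  sorted_kids : forall x y x' y', lvl x = lvl y -> lt x y ->
    x' \in kids root par x -> y' \in kids root par y -> lt x' y';
  sorted_root : 0 < K -> #|kids root par root| = R;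
  sorted_full : forall x, 0 < lvl x < K -> #|kids root par x| = b;
  sorted_last : forall x, K < lvl x -> #|kids root par x| = 0;
  sorted_arity : forall x, lvl x = K -> #|kids root par x| <= b;
  sorted_mono : forall x y, lvl x = K -> lvl y = K -> lt x y ->
    #|kids root par y| <= #|kids root par x|;
  sorted_one : forall x y, lvl x = K -> lvl y = K ->
    0 < #|kids root par x| < b -> 0 < #|kids root par y| < b -> x = y }.

(** On level [K] no node has exactly one child, so child counts are ordered as leaf counts are.
    Uniqueness of the partially filled node is the case [m = 0] of the hypothesis on mixed
    subtrees. *)
Lemma layered_sorted (V : finType) (e : rel V) (root : V) (par : V -> V)
    (lvl : V -> nat) (b K : nat) :
  ptree e root par lvl -> 2 <= b -> layered root par lvl b K ->
  (forall m u w, 0 < lvl u -> lvl u + m = K -> lvl w = lvl u -> u != w ->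
     lf root par lvl w <= lf root par lvl u -> b ^ m < lf root par lvl w ->
     lf root par lvl u < b ^ m.+1 -> False) ->
  sorted_layers root par lvl (ltr root par lvl) b.+1 b K.
Proof.
move=> T b2 Lay mixed; have K0 := layered_gt0 Lay.
have arityK x : lvl x = K -> #|kids root par x| = 0 \/ 2 <= #|kids root par x| <= b.
  move=> xK; case: (boolP (childless root par x)) => cx; [left|right].
    by move/eqP: cx => ->; rewrite cards0.
  exact: layered_arity Lay _ xK cx.
have one x y : lvl x = K -> lvl y = K -> 0 < #|kids root par x| < b ->
    0 < #|kids root par y| < b ->
    lf root par lvl y <= lf root par lvl x -> x = y.
  move=> xK yK hx hy hle; apply/eqP/negPn/negP => xy.
  have lx := lf_layer_last T b2 Lay xK; have ly := lf_layer_last T b2 Lay yK.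
  apply: (@mixed 0 x y) => //; rewrite ?xK ?yK ?addn0 //.
    by rewrite ly expn0; case: (arityK y yK); lia.
  by rewrite lx expn1; lia.
split.
- exact: ltr_irr.
- exact: ltr_trans T.
- exact: ltr_total T.
- exact: ltr_kids T.
- by move=> _; exact: layered_root Lay.
- exact: layered_full Lay.
- by move=> x /(layered_last Lay)/eqP ->; rewrite cards0.
- by move=> x /arityK; lia.
- move=> x y xK yK /(ltr_lf T b2 Lay mixed (etrans xK (esym yK))).
  rewrite xK K0 leqnn => /(_ isT); rewrite !(lf_layer_last T b2 Lay) //.
  by have := arityK y yK; lia.
move=> x y xK yK hx hy.
case/orP: (leq_total (lf root par lvl x) (lf root par lvl y)) => h;
  last exact: one.
by apply/esym; exact: one.
Qed.

(** * Sorted layers yield membership in the family *)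

Section Family.

Variables (V : finType) (e : rel V) (root : V) (par : V -> V) (lvl : V -> nat).
Hypothesis T : ptree e root par lvl.
Variables (lt : rel V) (R b K : nat).
Hypotheses (R0 : 0 < R) (b2 : 2 <= b).
Hypothesis S : sorted_layers root par lvl lt R b K.

Local Notation kids := (kids root par).

Lemma sorted_left_to_right : left_to_right e root lt.
Proof.
split; first exact: sorted_irr S.
- by move=> x y z; rewrite !(level_lvl T); apply: (sorted_trans S).
- by move=> x y; rewrite !(level_lvl T); apply: (sorted_total S).
move=> x y x' y'; rewrite !(level_lvl T) !(children_kids T).
exact: (sorted_kids S).
Qed.

Lemma card_next_lvl j :
  #|[set x | lvl x == j.+1]| = \sum_(x | lvl x == j) #|kids x|.
Proof.
have -> : #|[set x | lvl x == j.+1]| = \sum_(w | (w != root) && (lvl w == j.+1)) 1.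
  rewrite sum1dep_card; apply: eq_card => w; rewrite !inE.
  by case: (eqVneq w root) => [->|//]; rewrite (lvl_root T).
rewrite (sum_over_kids root par) [RHS]big_mkcond /=; apply: eq_bigr => x _.
case: ifP => hx; last first.
  by rewrite big_pred0 // => w;
    case: (boolP (w \in kids x)) => // /(lvl_kid T) ->; rewrite eqSS.
rewrite -sum1_card; apply: eq_bigl => w.
by case: (boolP (w \in kids x)) => // /(lvl_kid T) ->; rewrite eqSS.
Qed.

Lemma lvl_le_last x : lvl x <= K.+1.
Proof.
case: (eqVneq x root) => [->|xr]; first by rewrite (lvl_root T).
rewrite (lvl_par T xr) ltnS leqNgt; apply/negP => /(sorted_last S) /eqP.
by rewrite cards_eq0 => /eqP h; have := in_set0 x; rewrite -h inE xr eqxx.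
Qed.

Lemma card_lvl j : j < K -> #|[set x | lvl x == j.+1]| = R * b ^ j.
Proof.
elim: j => [|j IH] jK; rewrite card_next_lvl.
  rewrite (eq_bigl (pred1 root)) => [|x]; last by rewrite (lvl_eq0 T).
  by rewrite big_pred1_eq (sorted_root S) ?muln1.
rewrite (eq_bigr (fun=> b)) => [|x /eqP hx];
  last by rewrite (sorted_full S) // hx; lia.
rewrite sum_nat_cond_const -/(#|[set x | lvl x == j.+1]|) IH; last lia.
by rewrite expnSr mulnA.
Qed.

Lemma card_up_to_lvl j : #|[set x | lvl x <= j]| =
  1 + \sum_(t < j) #|[set x | lvl x == t.+1]|.
Proof.
elim: j => [|j IH].
  rewrite big_ord0 addn0 -(cards1 root); apply: eq_card => x.
  by rewrite !inE leqn0 (lvl_eq0 T).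
rewrite big_ord_recr /= addnA -IH -cardsUI.
have -> : [set x | lvl x <= j] :&: [set x | lvl x == j.+1] = set0.
  by apply/setP => x; rewrite !inE; lia.
by rewrite cards0 addn0; apply: eq_card => x; rewrite !inE leq_eqVlt ltnS orbC.
Qed.

Lemma card_sorted : #|V| = M R b.+1 K + \sum_(x | lvl x == K) #|kids x|.
Proof.
have -> : #|V| = #|[set x | lvl x <= K.+1]|.
  by rewrite -cardsT; apply: eq_card => x; rewrite !inE lvl_le_last.
rewrite card_up_to_lvl big_ord_recr /= card_next_lvl addnA; congr (_ + _ + _).
by apply: eq_bigr => t _; rewrite card_lvl.
Qed.

(** [#|fulls|] and [rest] turn out to be the quotient [m] and the remainder [r] in the definition of
    the family. *)
Let s (x : V) := #|kids x|.
Let fulls := [set x | (lvl x == K) && (s x == b)].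
Let rest := \sum_(x | (lvl x == K) && (s x != b)) s x.

Lemma sum_last : \sum_(x | lvl x == K) #|kids x| = #|fulls| * b + rest.
Proof.
rewrite (bigID (fun x => s x == b)) /=; congr (_ + _).
by rewrite (eq_bigr (fun=> b)) ?sum_nat_cond_const // => x /andP[_ /eqP].
Qed.

Lemma rest_mixed x : lvl x = K -> 0 < s x < b -> rest = s x.
Proof.
move=> xK hx; rewrite /rest (bigD1 x) /=; last by rewrite xK eqxx; lia.
rewrite big1 ?addn0 // => y /andP[/andP[/eqP yK yb] yx].
apply/eqP; rewrite -leqn0 leqNgt; apply/negP => y0.
move/eqP: yx; apply; apply: (sorted_one S) => //.
by have := sorted_arity S yK; rewrite -/(s y); lia.
Qed.

Lemma rest_neq0 : rest != 0 -> exists2 x, lvl x = K & 0 < s x < b.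
Proof.
rewrite /rest sum_nat_eq0 negb_forall => /existsP[x].
rewrite negb_imply => /andP[/andP[/eqP xK xb] x0].
by exists x; rewrite //; have := sorted_arity S xK; rewrite -/(s x); lia.
Qed.

Lemma rest_lt : rest < b.
Proof.
case: (eqVneq rest 0) => [->|/rest_neq0[x xK hx]]; first lia.
by rewrite (rest_mixed xK hx); lia.
Qed.

Lemma positionE x : position e root lt x = #|[set y | (lvl y == lvl x) && lt y x]|.
Proof. by rewrite /position; apply: eq_card => y;
  rewrite !inE !(level_lvl T). Qed.

(** Level [K] consists of the full nodes, then at most one partially filled node, then the childless
    ones; a position counts predecessors. *)
Lemma kids_by_position x : lvl x = K ->
  s x = if position e root lt x < #|fulls| then b
        else if position e root lt x == #|fulls| then rest else 0.
Proof.
move=> xK; rewrite positionE xK; have sx := sorted_arity S xK;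
  rewrite -/(s x) in sx.
have before_of y : lvl y = K -> s x < s y -> lt y x.
  move=> yK h; have yx : y != x by apply: contraTneq h => ->; rewrite ltnn.
  have := sorted_total S (etrans yK (esym xK)) yx.
  by case/orP => // /(sorted_mono S xK yK); rewrite -/(s x) -/(s y); lia.
case: (eqVneq (s x) b) => [xb|xb].
  rewrite ifT //; apply: proper_card; apply/properP; split.
    apply/subsetP => y; rewrite !inE => /andP[/eqP yK yx]; rewrite yK eqxx /=.
    have := sorted_mono S yK xK yx; have := sorted_arity S yK.
    by rewrite -/(s x) -/(s y); lia.
  by exists x; rewrite !inE xK eqxx ?xb ?eqxx // (sorted_irr S).
have sub : fulls \subset [set y | (lvl y == K) && lt y x].
  apply/subsetP => y; rewrite !inE => /andP[/eqP yK /eqP yb].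
  by rewrite yK eqxx before_of //; lia.
have hle := subset_leq_card sub; rewrite ltnNge hle /=.
case: (posnP (s x)) => x0.
  case: ifP => // hE; rewrite x0; apply/eqP; rewrite eq_sym; apply/negPn/negP.
  case/rest_neq0 => y yK hy;
    suff : #|fulls| < #|[set y | (lvl y == K) && lt y x]|.
    by lia.
  apply: proper_card; apply/properP; split => //; exists y;
    rewrite !inE yK eqxx /=.
    by apply: before_of; lia.
  by lia.
have hx : 0 < s x < b by lia.
rewrite ifT; first by rewrite (rest_mixed xK hx).
rewrite eqn_leq hle andbT; apply: subset_leq_card; apply/subsetP => y.
rewrite !inE => /andP[/eqP yK yx]; rewrite yK eqxx /=; apply/negPn/negP => yb.
have := sorted_mono S yK xK yx; have := sorted_arity S yK;
  rewrite -/(s x) -/(s y) => h1 h2.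
have yxE : y = x by apply: (sorted_one S) => //; rewrite -/(s y); lia.
by rewrite yxE (sorted_irr S) in yx.
Qed.

Lemma card_root_kids : 0 < K -> #|children e root root| = minn (#|V| - 1) R.
Proof.
move=> K0; rewrite (children_kids T) (sorted_root S K0).
have : R <= #|V|.-1; last lia.
rewrite -(sorted_root S K0) -[X in _ <= X](cardC1 root); apply: subset_leq_card.
by apply/subsetP => x; rewrite !inE => /andP[].
Qed.

Lemma M_S k : M R b.+1 k.+1 = M R b.+1 k + R * b ^ k.
Proof. by rewrite /M big_ord_recr /= addnA. Qed.

(** The index [k] of the family is [K], except when level [K] is completely filled. *)
Lemma sorted_in_family : 0 < K -> in_family R b.+1 e root lt.
Proof.
move=> K0; split; [exact: ptree_is_tree T|exact: sorted_left_to_right|].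
have cardK : #|[set x | lvl x == K]| = R * b ^ K.-1.
  by rewrite -{1}(prednK K0) card_lvl // prednK.
have cardV := card_sorted.
case: (boolP [forall x, (lvl x == K) ==> (s x == b)]) => [/forallP allb|].
  have hV : #|V| = M R b.+1 K.+1.
    rewrite cardV M_S (eq_bigr (fun=> b)) => [|x xK]; last first.
      by have := allb x; rewrite xK => /eqP.
    rewrite sum_nat_cond_const -/(#|[set x | lvl x == K]|) cardK -mulnA -expnSr.
    by rewrite prednK.
  (* A filled level [K] gives [#|V| = M R b.+1 K.+1], so the index moves up by one and [m = r = 0]
     on the childless level [K.+1]. *)
  exists K.+1; rewrite /= hV subnn div0n mod0n; split.
  - have : 0 < R * b ^ K.+1 by rewrite muln_gt0 R0 expn_gt0; lia.
    by rewrite leqnn (M_S K.+1); lia.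
  - by move=> w; rewrite (level_lvl T); apply: leq_trans (lvl_le_last w) _.
  - by rewrite -hV card_root_kids.
  - move=> w; rewrite (level_lvl T) (children_kids T) => hw.
    case: (ltngtP (lvl w) K) => wK; [|lia|].
      by apply: (sorted_full S); lia.
    by have := allb w; rewrite wK eqxx => /eqP.
  move=> w; rewrite (level_lvl T) (children_kids T) => hw.
  by rewrite (sorted_last S) ?hw // ltn0; case: ifP.
rewrite negb_forall => /existsP[x0]; rewrite negb_imply => /andP[/eqP x0K x0b].
have hdiv : #|V| - M R b.+1 K = #|fulls| * b + rest by rewrite cardV addKn sum_last.
exists K; rewrite /= hdiv divnMDl ?modnMDl; last lia.
rewrite (divn_small rest_lt) (modn_small rest_lt) addn0; split.
- rewrite M_S cardV leq_addr ltn_add2l -(prednK K0) expnSr mulnA -cardK.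
  rewrite -sum1dep_card big_distrl /= prednK // (bigD1 x0) ?x0K //=.
  rewrite [X in _ < X](bigD1 x0) ?x0K //= -addSn; apply: leq_add.
    by have := sorted_arity S x0K; rewrite -/(s x0); lia.
  by apply: leq_sum => x /andP[/eqP xK _]; rewrite mul1n (sorted_arity S).
- by move=> w; rewrite (level_lvl T) lvl_le_last.
- exact: card_root_kids.
- move=> w; rewrite (level_lvl T) (children_kids T) => hw.
  by apply: (sorted_full S); lia.
by move=> w; rewrite (level_lvl T) (children_kids T); apply: kids_by_position.
Qed.

(** The root is the only node on the last internal level. With [b] children it gives index 1, with
    fewer it is itself the node receiving [r] children and the index is 0. *)
Lemma star_in_family : K = 0 -> R = b -> in_family R b.+1 e root lt.
Proof.
move=> K0 Rb; split; [exact: ptree_is_tree T|exact: sorted_left_to_right|].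
have cardV : #|V| = 1 + #|kids root|.
  rewrite card_sorted K0 /M big_ord0 (eq_bigl (pred1 root)) => [|x].
    by rewrite big_pred1_eq addn0.
  by rewrite (lvl_eq0 T).
have sle : #|kids root| <= b by apply: (sorted_arity S); rewrite (lvl_root T).
have rootE : #|children e root root| = minn (#|V| - 1) R.
  by rewrite (children_kids T) cardV; lia.
have M0 : M R b.+1 0 = 1 by rewrite /M big_ord0.
have M1 : M R b.+1 1 = b.+1 by rewrite M_S M0 expn0 Rb; lia.
case: (eqVneq #|kids root| b) => [sb|sb].
  exists 1; rewrite /= M1 cardV sb subnn div0n mod0n; split.
  - have : 0 < R * b ^ 1 by rewrite muln_gt0 R0 expn_gt0; lia.
    by rewrite (M_S 1) M1; lia.
  - by move=> w; rewrite (level_lvl T); have := lvl_le_last w; lia.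
  - by rewrite rootE cardV sb.
  - by move=> w; lia.
  move=> w; rewrite (level_lvl T) (children_kids T) => hw.
  by rewrite (sorted_last S) ?hw ?K0 // ltn0; case: ifP.
exists 0; rewrite /= M0 cardV addKn divn_small ?modn_small; [|lia..]; split.
- by rewrite M1; lia.
- by move=> w; rewrite (level_lvl T); have := lvl_le_last w; lia.
- by rewrite rootE cardV addKn.
- by move=> w; lia.
move=> w; rewrite (level_lvl T) (children_kids T) => /eqP;
  rewrite (lvl_eq0 T) => /eqP ->.
suff -> : position e root lt root = 0 by [].
rewrite positionE (lvl_root T); apply/eqP; rewrite cards_eq0;
  apply/eqP/setP => y.
rewrite !inE (lvl_eq0 T); case: eqP => // ->; exact: sorted_irr S _.
Qed.

End Family.

(** * Passage to the subtree below a node *)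

Section Subtree.

Variables (V : finType) (e : rel V) (root : V) (par : V -> V) (lvl : V -> nat).
Hypothesis T : ptree e root par lvl.
Variable u : V.
Hypothesis ur : u != root.
Hypothesis hu : u \in subtree e root u.

Local Notation W := {x : V | x \in subtree e root u}.
Local Notation anc := (anc par lvl).

Definition sub_root : W := exist (fun w => w \in subtree e root u) u hu.
(** The default of [insubd] is reached only at [u], whose parent is outside the subtree. *)
Definition sub_par (x : W) : W := insubd sub_root (par (val x)).
Definition sub_lvl (x : W) : nat := lvl (val x) - lvl u.

Lemma in_subtree w : (w \in subtree e root u) = anc u w.
Proof. by rewrite (subtree_anc T ur) inE. Qed.

Lemma anc_val (x : W) : anc u (val x).
Proof. by rewrite -in_subtree; exact: valP x. Qed.

Lemma lvl_val (x : W) : lvl u <= lvl (val x).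
Proof. exact: anc_lvl (anc_val x). Qed.

Lemma val_neq_root (x : W) : val x != root.
Proof.
by rewrite -(lvl_gt0 T); apply: leq_trans (lvl_val x); rewrite (lvl_gt0 T).
Qed.

Lemma val_sub_par (x : W) : x != sub_root -> val (sub_par x) = par (val x).
Proof.
rewrite -val_eqE /= => xu; rewrite val_insubd in_subtree ifT //.
by apply: (anc_par_r T (anc_val x)); rewrite eq_sym.
Qed.

Lemma ptree_subtree :
  ptree (induced e (subtree e root u)) sub_root sub_par sub_lvl.
Proof.
have parE (x y : W) :
    (val x != root) && (par (val x) == val y) = (x != sub_root) && (sub_par x == y).
  rewrite val_neq_root /=; case: (eqVneq x sub_root) => [->|xr] /=.
    by apply/negP => /eqP/(congr1 lvl) h; have := lvl_val y;
      rewrite (lvl_par T ur) /= -h ltnn.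
  by rewrite -val_eqE (val_sub_par xr).
split.
- by rewrite /sub_lvl subnn.
- move=> x xr; have h := lvl_val (sub_par x); rewrite (val_sub_par xr) in h.
  by rewrite /sub_lvl (val_sub_par xr) (lvl_par T (val_neq_root x)); lia.
by move=> x y; rewrite /induced (ptree_edge T) !parE.
Qed.

Lemma kids_val (x y : W) :
  (y \in kids sub_root sub_par x) = (val y \in kids root par (val x)).
Proof.
rewrite !inE val_neq_root /=; case: (eqVneq y sub_root) => [->|yr] /=.
  by apply/esym/negP => /eqP/(congr1 lvl) h; have := lvl_val x;
    rewrite (lvl_par T ur) /= -h ltnn.
by rewrite -val_eqE (val_sub_par yr).
Qed.

Lemma card_kids_val (x : W) : #|kids sub_root sub_par x| = #|kids root par (val x)|.
Proof.
rewrite -(card_imset _ val_inj); apply: eq_card => y; apply/imsetP/idP.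
  by case=> y' hy ->; rewrite -kids_val.
move=> yx; have yA : y \in subtree e root u.
  rewrite in_subtree; apply: (anc_trans T) (anc_val x) _.
  exact: (anc_kid T).
by exists (exist (fun w => w \in subtree e root u) y yA); rewrite ?kids_val.
Qed.

Lemma sorted_subtree (lt : rel V) R b K :
  sorted_layers root par lvl lt R b K -> lvl u <= K.+1 ->
  sorted_layers sub_root sub_par sub_lvl (induced lt (subtree e root u)) b b
    (K - lvl u).
Proof.
move=> S uK.
have lvlE (x y : W) : sub_lvl x = sub_lvl y -> lvl (val x) = lvl (val y).
  by rewrite /sub_lvl; have := lvl_val x; have := lvl_val y; lia.
have u0 : 0 < lvl u by rewrite (lvl_gt0 T).
(* The subtraction truncates when [u] is on level [K.+1]; the subtree is then the single childless
   node [u]. *)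
have bottom (x : W) : sub_lvl x = K - lvl u ->
    lvl (val x) = K \/ lvl u = K.+1 /\ val x = u.
  rewrite /sub_lvl; have hx := lvl_val x; case: (leqP (lvl u) K) => h xE.
    by left; lia.
  right; split; first lia.
  have hE : lvl u = lvl (val x) by lia.
  by have := anc_val x; rewrite (anc_same_lvl par hE) => /eqP.
have kids_u : lvl u = K.+1 -> #|kids root par u| = 0.
  by move=> h; apply: (sorted_last S); rewrite h.
split.
- by move=> x; apply: (sorted_irr S).
- by move=> x y z /lvlE xy /lvlE yz; apply: (sorted_trans S).
- by move=> x y /lvlE xy; rewrite -val_eqE; apply: (sorted_total S).
- by move=> x y x' y' /lvlE xy; rewrite !kids_val; apply: (sorted_kids S).
- by move=> K0; rewrite card_kids_val (sorted_full S) //=; lia.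
- move=> x; rewrite card_kids_val /sub_lvl => hx; apply: (sorted_full S).
  by have := lvl_val x; lia.
- move=> x; rewrite card_kids_val /sub_lvl => hx; apply: (sorted_last S).
  by have := lvl_val x; lia.
- move=> x /bottom hx; rewrite card_kids_val; case: hx => [|[/kids_u h ->]].
    exact: (sorted_arity S).
  by rewrite h.
- move=> x y /bottom hx /bottom hy; rewrite !card_kids_val.
  case: hx hy => [xK|[h xu]] [yK|[h' yu]]; first exact: (sorted_mono S).
  + by have := lvl_val x; lia.
  + by have := lvl_val y; lia.
  by rewrite yu kids_u.
move=> x y /bottom hx /bottom hy; rewrite !card_kids_val.
case: hx hy => [xK|[h ->]]; last by rewrite kids_u.
case=> [yK|[h ->]]; last by rewrite kids_u.
by move=> h1 h2; apply: val_inj; apply: (sorted_one S).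
Qed.

End Subtree.

(** * From centrality for nodes to centrality for leaves *)

Lemma node_to_leaf_balance b i l L t : 2 <= b -> i.-1 * b.-1 + 3 <= L ->
  l <= t -> 2 * t <= L + i -> t <= 1 + b * (t - l) -> 2 * l <= L.
Proof.
move=> b2 h1 h2 h3 h5.
have [d tE] : exists d, t = l + d by exists (t - l); lia.
have [a bE] : exists a, b = a.+2 by exists (b - 2); lia.
rewrite tE addKn bE /= in h1 h3 h5 *.
(* Of [t] nodes below some node, [l] are leaves and [d] are internal. From [L < 2 * l] follows
   [2 * d < i], and an internal node adds at most [b - 1] leaves, so [2 * (l - 1) <= (i - 1) * (b -
   1) <= L - 3]. *)
rewrite leqNgt; apply/negP => h7.
have h8 : i * a.+1 + 2 <= L + a.
  by case: i h1 {h3} => [|i] /=; rewrite ?mulSn; lia.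
nia.
Qed.

Section Centers.

Variables (V : finType) (e : rel V) (root : V) (par : V -> V) (lvl : V -> nat).
Hypothesis T : ptree e root par lvl.
Variable b : nat.

Lemma ptree_arity : max_degree e <= b.+1 -> arity_le root par b.
Proof.
move=> h x; have : degree e x <= b.+1 by apply: leq_trans h; exact: leq_bigmax.
by rewrite (degree_kids T); case: eqP => _ /=; lia.
Qed.

Local Notation anc := (anc par lvl).
Local Notation kids := (kids root par).
Local Notation lf := (lf root par lvl).
Local Notation childless := (childless root par).

(** An only child of the root would have all of [F], except perhaps the root, below it. The set [F]
    is used as the leaves and as all nodes. *)
Lemma root_kids_gt1 (F : {set V}) : 2 < #|F| ->
  (forall u, u \in kids root -> 2 * #|[set w in F | anc u w]| <= #|F|) ->
  1 < #|kids root|.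
Proof.
move=> F2 hF; have F1 : 1 < #|F :\ root| by rewrite (cardsD1 root) in F2; lia.
have /card_gt0P[w] : 0 < #|F :\ root| by lia.
rewrite !inE => /andP[wr _]; have [u uk _] := kid_above T wr.
rewrite ltnNge; apply/negP => k1.
have kE : kids root = [set u].
  by apply/esym/eqP; rewrite eqEcard sub1set uk cards1.
have sub : F :\ root \subset [set w in F | anc u w].
  apply/subsetP => y; rewrite !inE => /andP[yr ->]; have [u'] := kid_above T yr.
  by rewrite kE inE => /eqP ->.
have := subset_leq_card sub; have := hF u uk; have := cardsD1 root F; lia.
Qed.

Lemma leaf_central_kids :
  (forall u, u \in kids root -> 2 * lf u <= lf root) ->
  forall u, u != root -> 2 * lf u <= lf root.
Proof.
move=> h u /(kid_above T)[w wk /(lf_anc T) hl].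
by apply: leq_trans (h w wk); rewrite leq_mul2l hl.
Qed.

Hypothesis b2 : 2 <= b.
Hypothesis Har : arity_le root par b.

(** Every node strictly below [u] is a child of one of the internal nodes below [u], each of which
    has at most [b] children. *)
Lemma card_below u : u != root ->
  #|[set w | anc u w]| <= 1 + b * (#|[set w | anc u w]| - lf u).
Proof.
move=> ur.
have E1 : #|[set w | anc u w]| =
    1 + \sum_(w | (w != root) && (anc u w && (w != u))) 1.
  rewrite (cardsD1 u) inE anc_refl sum1dep_card; congr (_ + _).
  apply: eq_card => w; rewrite !inE; case: (eqVneq w root) => [->|wr] /=.
    by rewrite (anc_of_root T) (negPf ur) andbF.
  by rewrite andbC.
have E2 : #|[set w | anc u w]| - lf u = \sum_(x | anc u x && ~~ childless x) 1.
  have -> : lf u = \sum_(x | anc u x && childless x) 1.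
    by rewrite /lf big_mkcond [RHS]big_mkcond /=; apply: eq_bigr => x _;
      do 2 case: ifP; case: (anc u x).
  rewrite -sum1dep_card (bigID childless) /= addKn.
  by [].
rewrite {1}E1 leq_add2l E2 (sum_over_kids root par) big_distrr /= muln1.
rewrite [X in _ <= X]big_mkcond /=; apply: leq_sum => x _.
have kE w : w \in kids x -> anc u w && (w != u) = anc u x.
  move=> wx; have := wx; rewrite inE => /andP[wr /eqP px].
  rewrite (ancE T) wr px; case: (eqVneq u w) => [uw|uw] /=;
    last by rewrite andbT.
  apply/esym/negP => /anc_lvl; rewrite uw (lvl_kid T wx); lia.
rewrite (eq_bigl (fun w => (w \in kids x) && anc u x)) => [|w]; last first.
  by case: (boolP (w \in kids x)) => // /kE ->.
case: (boolP (anc u x)) => ux; last by rewrite big_pred0 // => w; rewrite andbF.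
rewrite (eq_bigl (mem (kids x))) => [|w]; last by rewrite andbT.
rewrite sum1_card; case: (boolP (childless x)) => cx /=.
  by move/eqP: cx => ->; rewrite cards0.
have xr : x != root.
  by rewrite -(lvl_gt0 T); apply: leq_trans (anc_lvl ux); rewrite (lvl_gt0 T).
by have := Har x; rewrite (negPf xr) addn0.
Qed.

Lemma central_leaf_central : b < lf root ->
  #|V| = lf root + internal_count b (lf root) -> central e root ->
  forall u, u \in kids root -> 2 * lf u <= lf root.
Proof.
move=> bL cardV cen u uk; have ur : u != root by move: uk;
  rewrite inE => /andP[].
have /andP[hi _] := internal_countP b2 bL.
apply: (node_to_leaf_balance b2 hi _ _ (card_below ur)).
  rewrite /lf -sum1dep_card big_mkcond [X in _ <= X]big_mkcond /=.
  by apply: leq_sum => x _; case: ifP; case: (anc u x).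
have := cen u ur; have := subset_leq_card (component_below T uk).
by rewrite cardV; lia.
Qed.

End Centers.

(** * Assembly: rooting first at a median of the leaves, then at the central node *)

Theorem theorem2 (Delta : nat) (V : finType) (e : rel V) (v : V)
    (hDelta : 3 <= Delta) (hT : is_tree e) (hdeg : max_degree e = Delta)
    (hmin : forall (V' : finType) (e' : rel V'),
       is_tree e' -> max_degree e' <= Delta -> #|leaves e'| = #|leaves e| ->
       sigma_LL e <= sigma_LL e')
    (hv : central e v) :
  exists lt : rel V,
    in_family Delta Delta e v lt /\
    forall u : V, u != v ->
      exists hu : u \in subtree e v u,
        in_family Delta.-1 Delta (induced e (subtree e v u))
          (exist (fun w => w \in subtree e v u) u hu)
          (induced lt (subtree e v u)).
Proof.
case: Delta hDelta hdeg hmin => // b b2 hdeg hmin.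
rewrite ltnS in b2; rewrite [b.+1.-1]/=.
have ar r par lvl : ptree e r par lvl -> arity_le r par b.
  by move=> T; apply: (ptree_arity T); rewrite hdeg.
(* Rooted at a node of maximum degree, the tree has a leaf below each of the [b.+1] children. *)
have bL : b < #|leaves e|.
  case: (hT) => _ _ V0 _ _; have [z hz] := eq_bigmax (degree e) V0.
  have [par [lvl T]] := is_tree_ptree z hT.
  have zk : #|kids z par z| = b.+1.
    by rewrite -hdeg /max_degree hz (degree_kids T) eqxx addn0.
  rewrite (leaves_childless T) ?zk; last lia.
  by rewrite -(lf_root T) -zk; exact: lf_root_ge_kids T.
have leavesE r par lvl : ptree e r par lvl -> 1 < #|kids r par r| ->
    (forall u, #|[set w in leaves e | anc par lvl u w]| = lf r par lvl u) /\
    #|leaves e| = lf r par lvl r.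
  move=> T r2; rewrite (leaves_childless T r2) -(lf_root T); split=> // u.
  rewrite -sum1dep_card /lf big_mkcond [RHS]big_mkcond /=;
    apply: eq_bigr => w _.
  by rewrite inE; case: (childless _ _ _); case: (anc _ _ _ _).
have cardV : #|V| = #|leaves e| + internal_count b #|leaves e|.
  pose D x := \sum_(w in leaves e) dist e x w.
  (* The number of nodes is needed before [v] is known to be leaf-central. It is found from a node
     [c] with the least sum of distances to the leaves, below each of whose neighbours lie at most
     half of them. *)
  case: (arg_minnP (P := xpredT) (i0 := v) D isT) => c _ cmin.
  have [par [lvl T]] := is_tree_ptree c hT.
  have half u : u \in kids c par c -> 2 * #|[set w in leaves e | anc par lvl u w]| <= #|leaves e|.
    move=> uk; have := sum_dist_kid T (leaves e) uk; have := cmin u isT.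
    rewrite /D;
      have -> : \sum_(w in leaves e) anc par lvl u w = #|[set w in leaves e | anc par lvl u w]|.
      rewrite -sum1dep_card big_mkcond [RHS]big_mkcond /=;
        apply: eq_bigr => w _.
      by case: (w \in leaves e); case: (anc _ _ _ _).
    by lia.
  have c2 : 1 < #|kids c par c| by apply: (root_kids_gt1 T (F := leaves e)) => //; lia.
  have [lfE LE] := leavesE _ _ _ T c2; rewrite LE.
  apply: (optimal_card T b2 (ar _ _ _ T) c2); rewrite -?LE //.
    by rewrite LE; apply: (leaf_central_kids T) => u uk; rewrite -lfE -LE;
      apply: half.
have [par [lvl T]] := is_tree_ptree v hT; have Har := ar _ _ _ T.
have v2 : 1 < #|kids v par v|.
  apply: (root_kids_gt1 T (F := [set: V])); first by rewrite cardsT cardV; lia.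
  move=> u uk; have uv : u != v by move: uk; rewrite inE => /andP[].
  rewrite cardsT; apply: leq_trans (hv u uv); rewrite leq_mul2l /=.
  apply: leq_trans (subset_leq_card (component_below T uk)).
  by apply: subset_leq_card; apply/subsetP => w; rewrite !inE.
have [_ LE] := leavesE _ _ _ T v2; rewrite LE in bL cardV hmin.
(* With the number of nodes known, centrality of [v] passes from nodes to leaves, and the comparison
   applies at [v] itself. *)
have cen := leaf_central_kids T (central_leaf_central T b2 Har bL cardV hv).
have opt := optimal_slack T b2 Har v2 bL cen hmin.
have [K Lay] := optimal_layered T b2 Har bL cen opt.
have mixed := optimal_one_mixed T b2 Har bL cen opt Lay.
have S : sorted_layers v par lvl (ltr v par lvl) b.+1 b K.
  exact: layered_sorted T b2 Lay mixed.
have K0 := layered_gt0 Lay.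
exists (ltr v par lvl); split;
  first exact (sorted_in_family T (ltn0Sn b) b2 S K0).
move=> u uv;
  have hu : u \in subtree e v u by rewrite (in_subtree T uv) anc_refl.
exists hu; have Tu := ptree_subtree T uv hu.
have Su := sorted_subtree T uv hu S (lvl_le_last T S u).
have b0 : 0 < b by lia.
(* For [u] on level [K] or [K.+1] the subtree is a star or a single node. *)
case: (posnP (K - lvl u)) => Ku.
  exact (star_in_family Tu b0 b2 Su Ku erefl).
exact (sorted_in_family Tu b0 b2 Su Ku).
Qed.
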